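(* There is no strongly regular graph with parameters $(76,30,8,14)$.
   Context: A finite simple undirected graph is strongly regular with parameters $(v,k,\lambda,\mu)$ if it has $v$ vertices, is $k$-regular, every two adjacent vertices have exactly $\lambda$ common neighbours, and every two distinct non-adjacent vertices have exactly $\mu$ common neighbours. *)

(* Defs.v *)
From mathcomp Require Import all_boot.
Set Implicit Arguments. Unset Strict Implicit. Unset Printing Implicit Defensive.

Definition simple_graph (T : finType) (e : rel T) : Prop :=
  irreflexive e /\ symmetric e.

Definition nbhd (T : finType) (e : rel T) (x : T) : {set T} := [set y | e x y].

Definition srg (T : finType) (e : rel T) (v k lam mu : nat) : Prop :=
  [/\ simple_graph e,
      #|T| = v,
      (forall x : T, #|nbhd e x| = k),
      (forall x y : T, e x y -> #|nbhd e x :&: nbhd e y| = lam)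
    & (forall x y : T, x != y -> ~~ e x y -> #|nbhd e x :&: nbhd e y| = mu)].

(* Main.v *)
(** The graph is represented by vectors of norm 5 in a 19-dimensional Euclidean space, with inner
    products 2 (adjacent) and 3 (non-adjacent); a vector [u] of that space is encoded by the
    function [x |-> <u, x>], which is [good].

    Positivity of the norm of a symmetric 4-tensor forces a 4-clique.  A 4-clique yields a root
    (norm 2) having inner product 1 with forty vertices and 0 with the other thirty-six.  If three of
    the latter form a triangle, a further short vector exists, and it describes either a coclique of
    size 16 or an induced K_{6,10}.  If they are triangle-free, the 36 vertices project onto a plane
    as vectors whose integral inner products are contradictory.  In the two remaining cases the other
    60 vertices project onto 2 or 3 dimensions with very few directions; the 20 vertices sharing a
    direction carry a 2-regular graph [A] such that [2 - A] is proportional to a Gram matrix of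
    vectors in 15 dimensions, which a trace and parity argument excludes. *)

Require Import Defs.
From mathcomp Require Import all_boot all_order all_algebra.
From mathcomp Require Import ring lra zify.
Set Implicit Arguments. Unset Strict Implicit. Unset Printing Implicit Defensive.
Import Order.TTheory GRing.Theory Num.Theory.

(** The adjacency matrix [A] of the graph has eigenvalues 30, 2 and -8, and the 19-dimensional space
    is the eigenspace of -8 together with the constants. For good functions [n] and [m] the inner
    product of the encoded vectors is [(sum n m) / 10 - (sum n) (sum m) / 800]. A vector with
    integral values on the vertices is thus controlled by [sum n] and [sum n^2], and most steps show
    that a sum of squares, or of products of consecutive integers, vanishes, so that each term does.

    In the closing obstruction a kernel of dimension 5 of [2 - A], for the 2-regular [A] on twenty
    vertices, means at least five cycles. Triangles being impossible, there are exactly five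
    4-cycles, with eigenvalues 2, 0, 0, -2 each. The traces of the first four powers carry the same
    information without any decomposition into cycles. *)

Section Obstruction.
Local Open Scope ring_scope.

(** * Twenty vectors in fifteen dimensions: the final obstruction *)

Lemma sum_sq_eq0 (I : finType) (f : I -> int) :
  \sum_x f x * f x <= 0 -> forall x, f x = 0.
Proof.
move=> h x; have p (y : I) : true -> 0 <= f y * f y by rewrite -expr2 sqr_ge0.
have /eqP : \sum_x f x * f x = 0 by apply/eqP; rewrite eq_le h sumr_ge0.
by rewrite psumr_eq0 // => /allP /(_ x (mem_index_enum x)) /=; rewrite mulf_eq0 orbb => /eqP.
Qed.

(** The trace of [W W] is the sum of the squared entries when [W] is symmetric; a single trace
    inequality thus yields a matrix identity. *)
Lemma mxtrace_sym_sq_le0 (m : nat) (W : 'M[rat]_m) : W^T = W -> \tr (W *m W) <= 0 -> W = 0.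
Proof.
move=> sW; rewrite /mxtrace => h.
have s i : (W *m W) i i = \sum_j W i j * W i j.
  by rewrite mxE; apply: eq_bigr => j _; congr (_ * _); rewrite -{1}sW mxE.
have p i j : 0 <= W i j * W i j by rewrite -expr2 sqr_ge0.
have /eqP : \sum_i (W *m W) i i = 0.
  by apply/eqP; rewrite eq_le h sumr_ge0 // => i _; rewrite s sumr_ge0.
rewrite psumr_eq0 => [/allP z|i _]; last by rewrite s sumr_ge0.
apply/matrixP => i j; have /= := z i (mem_index_enum i).
rewrite s psumr_eq0 // => /allP /(_ j (mem_index_enum j)) /=.
by rewrite mulf_eq0 orbb mxE => /eqP.
Qed.

(* The Gram matrix [M = 2 - A] of twenty vectors spanning at most fifteen dimensions has
   a kernel of dimension at least five.  The traces of [M], [M^2], [M^3] and [M^4] then leave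
   no slack: the nonzero eigenvalues of [N = X^T X / c] are 2 and 4, that is, [1 - 3/4 N + 1/8 N^2]
   is the projection onto [k]. *)
Lemma gram_projection (n m : nat) (A : 'M[rat]_n) (X : 'M[rat]_(n, m)) (k : 'cV[rat]_m) (c : rat) :
    n = 20%N -> m = 16%N -> c != 0 -> \tr A = 0 -> \tr (A *m A) = 40 -> \tr (A *m A *m A) = 0 ->
    \tr (A *m A *m (A *m A)) <= 160 ->
    X *m X^T = c *: (2%:M - A) -> X *m k = 0 -> k^T *m k = 16%:M ->
  let N := c^-1 *: (X^T *m X) in
  1%:M - (3 / 4) *: N + (1 / 8) *: (N *m N) = (1 / 16) *: (k *m k^T).
Proof.
move=> n20 m16 c0 tA tAA tA3 tA4 XX Xk kk N.
have {}n20 : n%:R = 20 :> rat by rewrite n20.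
have {}m16 : m%:R = 16 :> rat by rewrite m16.
pose M : 'M[rat]_n := 2%:M - A.
(* Since [X X^T = c M], a factor [N] on the left becomes a factor [M] inside the sandwich, and
   traces of powers of [N] become traces of powers of [M]. *)
have NN (Y : 'M[rat]_n) : N *m (c^-1 *: (X^T *m Y *m X)) = c^-1 *: (X^T *m (M *m Y) *m X).
  rewrite /N -scalemxAl -scalemxAr !mulmxA -(mulmxA X^T X X^T) XX -/M.
  rewrite -scalemxAr -!scalemxAl !scalerA; congr (_ *: _).
  by field.
have N1 : N = c^-1 *: (X^T *m 1%:M *m X) by rewrite mulmx1.
have trN (Y : 'M[rat]_n) : \tr (c^-1 *: (X^T *m Y *m X)) = \tr (M *m Y).
  rewrite mxtraceZ -mulmxA mxtrace_mulC -mulmxA XX -/M -scalemxAr mxtraceZ mulrA mulVf //.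
  by rewrite mul1r mxtrace_mulC.
have MM : M *m M = 4%:M - 4 *: A + A *m A.
  rewrite /M mulmxBl !mulmxBr mul_scalar_mx mul_mx_scalar mul_scalar_mx scale_scalar_mx.
  by apply/matrixP => i j; rewrite !mxE; ring.
have t1 : \tr N = 40.
  by rewrite N1 trN mulmx1 /M raddfB /= tA mxtrace_scalar -(mulr_natr 2 n) n20 subr0.
have t2 : \tr (N *m N) = 120.
  rewrite {2}N1 NN trN mulmx1 MM raddfD raddfB /= mxtraceZ tA tAA mxtrace_scalar.
  by rewrite -(mulr_natr 4 n) n20 mulr0 subr0.
have t3 : \tr (N *m (N *m N)) = 400.
  rewrite {3}N1 !NN trN mulmx1 MM /M mulmxBl mul_scalar_mx mulmxDr mulmxBr mul_mx_scalar.
  rewrite -scalemxAr mulmxA !(raddfD, raddfB, raddfN, mxtraceZ) /=.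
  rewrite !(raddfD, raddfB, raddfN) /= !mxtraceZ mxtrace_scalar.
  rewrite tA tAA tA3 n20; lra.
have t4 : \tr (N *m N *m (N *m N)) <= 1440.
  rewrite -mulmxA {4}N1 !NN trN mulmx1 mulmxA MM.
  rewrite mulmxDl mulmxBl !mulmxDr !mulmxN !mul_scalar_mx !mul_mx_scalar.
  rewrite -!scalemxAl -!scalemxAr !(raddfD, raddfB, raddfN) /= !mxtraceZ.
  rewrite !mxtrace_scalar; move: tA4; rewrite !mulmxA tA tAA tA3 n20; lra.
have NT : N^T = N by rewrite /N linearZ /= trmx_mul trmxK.
have Nk : N *m k = 0 by rewrite /N -scalemxAl -mulmxA Xk mulmx0 scaler0.
clear XX Xk NN N1 trN MM; move: N NT Nk t1 t2 t3 t4 => {X} N NT Nk t1 t2 t3 t4.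
set K := (1 / 16) *: _; set V := _ + _.
have NK : N *m K = 0 by rewrite /K -scalemxAr mulmxA Nk mul0mx scaler0.
have KT : K^T = K by rewrite /K linearZ /= trmx_mul trmxK.
have VT : V^T = V.
  by rewrite /V raddfD raddfB /= trmx1 !linearZ /= trmx_mul !NT.
have VK : V *m K = K.
  by rewrite /V mulmxDl mulmxBl mul1mx -!scalemxAl -mulmxA NK mulmx0 !scaler0 subr0 addr0.
have KV : K *m V = K by rewrite -[K *m V]trmxK trmx_mul VT KT VK KT.
have KK : K *m K = K.
  rewrite /K -scalemxAl -scalemxAr mulmxA -(mulmxA k) kk.
  by rewrite mul_mx_scalar -scalemxAl !scalerA; congr (_ *: _).
have tK : \tr K = 1 by rewrite /K mxtraceZ mxtrace_mulC kk mxtrace_scalar.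
have tV : \tr (V *m V) = 16 - 3 / 2 * \tr N + (9 / 16 + 1 / 4) * \tr (N *m N)
    - 3 / 16 * \tr (N *m (N *m N)) + 1 / 64 * \tr (N *m N *m (N *m N)).
  rewrite /V mulmxDl mulmxBl !mulmxDr !mulmxN !mul1mx !mulmx1 -!scalemxAl -!scalemxAr.
  rewrite !(raddfD, raddfB, raddfN) /= !mxtraceZ mxtrace1 m16 !mulmxA.
  by field.
(* As [V K = K V = K = K K], the trace of [(V - K)^2] is [tr (V V) - tr K], and the computed traces
   give [tr (V V) <= 1 = tr K]. *)
apply/eqP; rewrite -subr_eq0; apply/eqP; apply: mxtrace_sym_sq_le0.
  by rewrite raddfB /= VT KT.
rewrite mulmxBl !mulmxBr VK KV KK subrr subr0 raddfB /= tK tV t1 t2 t3; lra.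
Qed.

Lemma int_sq1 (h : int) : h * h = 1 -> h = 1 \/ h = - 1.
Proof. by move/eqP; rewrite -expr2 sqrf_eq1 => /orP[] /eqP ->; [left | right]. Qed.

Lemma sum_sym_even (I : finType) (f : I -> I -> int) :
  (forall i j, f i j = f j i) -> (forall i, f i i = 0) ->
  exists q : int, \sum_i \sum_j f i j = 2 * q.
Proof.
move=> sf f0.
pose lt (i j : I) := (enum_rank i < enum_rank j)%N.
exists (\sum_i \sum_(j | lt i j) f i j).
have -> : \sum_i \sum_j f i j = \sum_i \sum_(j | lt i j) f i j + \sum_i \sum_(j | lt j i) f i j.
  rewrite -big_split /=; apply: eq_bigr => i _.
  rewrite (bigID (lt i)) /=; congr (_ + _).
  rewrite (bigD1 i) /=; last by rewrite /lt ltnn.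
  rewrite f0 add0r; apply: eq_bigl => j; rewrite /lt -leqNgt ltn_neqAle andbC.
  by congr (_ && _); rewrite (inj_eq val_inj) (inj_eq enum_rank_inj).
rewrite mulrDl !mul1r; congr (_ + _).
rewrite (exchange_big_dep xpredT) //=; apply: eq_bigr => i _.
by apply: eq_bigr => j _.
Qed.

(* Summing over the edges, [h] changes sign on an even number of edges of the 2-regular graph [a],
   so [h^T A h] is divisible by 8, while [gram_projection] forces it to be [-20]. *)
Lemma no_regular_gram (T : finType) (U C : {set T}) (a : T -> T -> int) (X : T -> T -> rat)
    (h : T -> int) (k v : T -> rat) (c : rat) :
    #|U| = 20%N -> #|C| = 16%N -> c != 0 ->
    {in U &, forall x y, a x y = a y x} -> {in U &, forall x y, a x y * a x y = a x y} ->
    {in U, forall x, a x x = 0} -> {in U, forall x, \sum_(y in U) a x y = 2} ->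
    {in U &, forall x y,
      \sum_(p in C) X x p * X y p = c * (2 * (x == y)%:R - (a x y)%:~R)} ->
    {in U, forall x, \sum_(p in C) X x p * k p = 0} -> \sum_(p in C) k p * k p = 16 ->
    \sum_(p in C) v p * k p = 0 -> \sum_(p in C) v p * v p = 15 / (2 * c) ->
    {in U, forall x, \sum_(p in C) X x p * v p = (h x)%:~R} -> {in U, forall x, h x * h x = 1} ->
  False.
Proof.
move=> cU cC c0 sa aa a0 a2 XX Xk kk vk vv Xv hh.
pose u (i : 'I_#|U|) := enum_val i; pose w (j : 'I_#|C|) := enum_val j.
have uU i : u i \in U := enum_valP i.
pose A : 'M[rat]_#|U| := \matrix_(i, j) (a (u i) (u j))%:~R.
pose XM : 'M[rat]_(#|U|, #|C|) := \matrix_(i, j) X (u i) (w j).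
pose kM : 'cV[rat]_#|C| := \col_j k (w j).
pose vM : 'cV[rat]_#|C| := \col_j v (w j).
pose hM : 'cV[rat]_#|U| := \col_i (h (u i))%:~R.
have aint x y : x \in U -> y \in U -> a x y = 0 \/ a x y = 1.
  move=> xU yU; have /eqP := aa x y xU yU; rewrite -subr_eq0 -[X in _ - X]mulr1 -mulrBr mulf_eq0.
  by case/orP => /eqP H; [left | right; apply/eqP; rewrite -subr_eq0 H].
(* The three rows of [X] at a triangle have a sum of norm [c (3 * 2 - 6 * 1) = 0], so
   [h x + h y + h z = 0], impossible for three odd numbers. *)
have triangle_free x y z : x \in U -> y \in U -> z \in U -> a x y * a y z * a z x = 0.
  move=> xU yU zU.
  have [-> | xy] := aint x y xU yU; first by rewrite !mul0r.
  have [-> | yz] := aint y z yU zU; first by rewrite mulr0 mul0r.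
  have [-> | zx] := aint z x zU xU; first by rewrite mulr0.
  have ne p q : q \in U -> a p q = 1 -> (p == q) = false.
    by move=> qU; case: eqVneq => // ->; rewrite a0.
  have /eqP s0 : \sum_(p in C) (X x p + X y p + X z p) ^+ 2 = 0.
    have -> : \sum_(p in C) (X x p + X y p + X z p) ^+ 2 =
       \sum_(p in C) X x p * X x p + \sum_(p in C) X y p * X y p + \sum_(p in C) X z p * X z p
       + 2 * (\sum_(p in C) X x p * X y p) + 2 * (\sum_(p in C) X y p * X z p)
       + 2 * (\sum_(p in C) X z p * X x p).
      by rewrite !mulr_sumr -!big_split /=; apply: eq_bigr => p _; ring.
    rewrite !XX // !eqxx !a0 // xy yz zx (ne x y) // (ne y z) // (ne z x) //= !(mulr0z, mulr1z, mulr0n, mulr1n). ring.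
  have sX p : p \in C -> X x p + X y p + X z p = 0.
    move: s0; rewrite psumr_eq0 => [/allP H pC|? _]; last exact: sqr_ge0.
    by have := H p (mem_index_enum p); rewrite pC sqrf_eq0 => /eqP.
  have : (h x + h y + h z)%:~R = 0 :> rat.
    rewrite !intrD -!Xv // -!big_split /= big1 // => p pC.
    by rewrite -!mulrDl sX ?mul0r.
  move/eqP; rewrite intr_eq0 => /eqP.
  by case: (int_sq1 (hh x xU)) => ->; case: (int_sq1 (hh y yU)) => ->; case: (int_sq1 (hh z zU)) => ->.
pose b i j := \sum_l a (u i) (u l) * a (u l) (u j).
have sumU (F : T -> int) : \sum_(y in U) F y = \sum_i F (u i) by rewrite big_enum_val.
have sumC (F : T -> rat) : \sum_(y in C) F y = \sum_j F (w j) by rewrite big_enum_val.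
have AA i j : (A *m A) i j = (b i j)%:~R.
  rewrite mxE rmorph_sum /=; apply: eq_bigr => l _; rewrite !mxE.
  by rewrite -intrM.
have bii i : b i i = 2.
  rewrite -(a2 (u i) (uU i)) sumU; apply: eq_bigr => l _.
  by rewrite (sa (u l)) ?aa // ?uU.
have bsum i : \sum_j b i j = 4.
  rewrite exchange_big /= (eq_bigr (fun l => 2 * a (u i) (u l))).
    by rewrite -mulr_sumr -(sumU (a (u i))) a2.
  by move=> l _; rewrite -mulr_sumr -(sumU (a (u l))) a2 // mulrC.
have b0 i j : 0 <= b i j.
  rewrite sumr_ge0 // => l _; have [-> | ->] := aint _ _ (uU i) (uU l); rewrite ?mul0r //.
  by have [-> | ->] := aint _ _ (uU l) (uU j).
(* Off the diagonal, row [i] of [A^2] consists of non-negative integers of sum 2, so their squares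
   add up to at most 4. *)
have bb i : \sum_j b i j * b i j <= 8.
  have : \sum_(j | j != i) b i j = 2.
    by have := bsum i; rewrite (bigD1 i) //= bii; move: (\sum_(j | _) _) => t; lia.
  move=> s2; rewrite (bigD1 i) //= bii.
  have : \sum_(j | j != i) b i j * b i j <= \sum_(j | j != i) 2 * b i j.
    apply: ler_sum => j ji; apply: ler_wpM2r => //.
    by rewrite -s2 (bigD1 j) //= lerDl sumr_ge0.
  by rewrite -mulr_sumr s2; move: (\sum_(j | _) _) => t; lia.
have bs i j : b i j = b j i.
  by apply: eq_bigr => l _; rewrite mulrC (sa (u l)) ?(sa (u i)) ?uU.
have cU1 : \sum_(i < #|U|) 1 = 20%:R :> int by rewrite sumr_const card_ord cU.
have tA : \tr A = 0 by rewrite /mxtrace big1 // => i _; rewrite mxE a0.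
have tAA : \tr (A *m A) = 40.
  rewrite /mxtrace (eq_bigr (fun=> 2)) => [|i _]; last by rewrite AA bii.
  by rewrite sumr_const card_ord cU.
have tA3 : \tr (A *m A *m A) = 0.
  rewrite /mxtrace big1 // => i _; rewrite mxE big1 // => j _.
  rewrite AA mxE -intrM; apply/eqP; rewrite intr_eq0 /b mulr_suml big1 // => l _.
  by rewrite triangle_free ?uU.
have tA4 : \tr (A *m A *m (A *m A)) <= 160.
  have -> : \tr (A *m A *m (A *m A)) = (\sum_i \sum_j b i j * b i j)%:~R.
    rewrite /mxtrace rmorph_sum /=; apply: eq_bigr => i _.
    rewrite mxE rmorph_sum /=; apply: eq_bigr => j _.
    by rewrite !AA -intrM (bs j).
  rewrite -[160]/(160%:~R) ler_int.
  apply: (le_trans (ler_sum _ (fun i _ => bb i))).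
  by rewrite sumr_const card_ord cU.
have XXM : XM *m XM^T = c *: (2%:M - A).
  apply/matrixP => i j; rewrite !mxE (eq_bigr (fun l => X (u i) (w l) * X (u j) (w l))).
    rewrite -(sumC (fun p => X (u i) p * X (u j) p)) XX ?uU // (inj_eq enum_val_inj).
    by rewrite mulr_natr.
  by move=> l _; rewrite !mxE.
have XkM : XM *m kM = 0.
  apply/matrixP => i j; rewrite !mxE -[RHS](Xk (u i)) // sumC.
  by apply: eq_bigr => l _; rewrite !mxE.
have kkM : kM^T *m kM = 16%:M.
  apply/matrixP => i j; rewrite !mxE !ord1 eqxx mulr1n -[RHS]kk sumC.
  by apply: eq_bigr => l _; rewrite !mxE.
have W := gram_projection cU cC c0 tA tAA tA3 tA4 XXM XkM kkM.
have XvM : XM *m vM = hM.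
  apply/matrixP => i j; rewrite !mxE -Xv // sumC.
  by apply: eq_bigr => l _; rewrite !mxE.
have vvM : vM^T *m vM = (15 / (2 * c))%:M.
  apply/matrixP => i j; rewrite !mxE !ord1 eqxx mulr1n -[RHS]vv sumC.
  by apply: eq_bigr => l _; rewrite !mxE.
have vkM : vM^T *m kM = 0.
  apply/matrixP => i j; rewrite !mxE -[RHS]vk sumC.
  by apply: eq_bigr => l _; rewrite !mxE.
have hhM : hM^T *m hM = 20%:M.
  apply/matrixP => i j; rewrite !mxE !ord1 eqxx (eq_bigr (fun=> 1)) => [|l _].
    by rewrite sumr_const card_ord cU.
  by rewrite !mxE -intrM hh.
set N : 'M_(_, _) := c^-1 *: (XM^T *m XM) in W.
have Nv : N *m vM = c^-1 *: (XM^T *m hM) by rewrite /N -scalemxAl -mulmxA XvM.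
have vX : vM^T *m XM^T = hM^T by rewrite -trmx_mul XvM.
have vNv : vM^T *m (N *m vM) = (c^-1 * 20)%:M.
  by rewrite Nv -scalemxAr mulmxA vX hhM scale_scalar_mx.
have vNNv : vM^T *m (N *m (N *m vM)) = c^-1 *: (hM^T *m ((2%:M - A) *m hM)).
  rewrite Nv /N -!scalemxAl -!scalemxAr !mulmxA vX -(mulmxA _ XM) XXM scalerA.
  by rewrite -scalemxAr -scalemxAl scalerA; congr (_ *: _); field.
clearbody N; have hAh : hM^T *m (A *m hM) = (\sum_i \sum_j h (u i) * a (u i) (u j) * h (u j))%:~R%:M.
  apply/matrixP => i j; rewrite !mxE !ord1 eqxx mulr1n rmorph_sum /=.
  apply: eq_bigr => l _; rewrite !mxE mulr_sumr rmorph_sum /=.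
  by apply: eq_bigr => l' _; rewrite !mxE !intrM mulrA.
set S := \sum_i _ in hAh.
(* The projection identity is evaluated as a quadratic form at [v]: the right side vanishes, and the
   left terms come from [<v, v> = 15 / (2 c)], [<v, N v> = 20 / c] and
   [<v, N N v> = (40 - S) / c]. *)
have S20 : S = - 20.
  have := congr1 (fun Y => vM^T *m (Y *m vM)) W.
  rewrite /= mulmxDl mulmxBl mulmxDr mulmxBr mul1mx -!scalemxAl -!scalemxAr vvM.
  rewrite -(mulmxA N) -(mulmxA kM) vNv vNNv (mulmxA vM^T kM) vkM mul0mx scaler0.
  rewrite mulmxBl mulmxBr mul_scalar_mx -scalemxAr hhM hAh.
  move/matrixP => /(_ 0 0); rewrite !mxE eqxx !mulr1n => H.
  suff : S%:~R = (- 20)%:~R :> rat by move/eqP; rewrite eqr_int => /eqP.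
  rewrite -[RHS]/(- 20).
  have : c * (15 / (2 * c) - 3 / 4 * (c^-1 * 20) + 1 / 8 * (c^-1 * (2 * 20 - S%:~R))) = 0.
    by rewrite H mulr0.
  have -> : c * (15 / (2 * c) - 3 / 4 * (c^-1 * 20) + 1 / 8 * (c^-1 * (2 * 20 - S%:~R))) =
     15 / 2 - 15 + 1 / 8 * (40 - S%:~R) by field.
  lra.
(* With [h = 2 f - 1], [S] becomes [4 F - 8 (sum f) + 40], where [F] is even as a symmetric sum with
   zero diagonal; so 8 divides [S]. *)
pose f i := if h (u i) == 1 then 1 else 0 : int.
have fE i : h (u i) = 2 * f i - 1.
  by rewrite /f; case: (int_sq1 (hh _ (uU i))) => ->.
have [q qE] : exists q, \sum_i \sum_j f i * f j * a (u i) (u j) = 2 * q.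
  apply: sum_sym_even => [i j|i]; last by rewrite a0 ?mulr0 ?uU.
  by rewrite (mulrC (f i)) (sa (u i)) ?uU.
have row i : \sum_j a (u i) (u j) = 2 by rewrite -(sumU (a (u i))) a2.
have SE : S = 4 * (\sum_i \sum_j f i * f j * a (u i) (u j)) - 8 * (\sum_i f i) + 40.
  have -> : S = \sum_i \sum_j (4 * (f i * f j * a (u i) (u j))
      - 2 * (f i * a (u i) (u j)) - 2 * (f j * a (u j) (u i)) + a (u i) (u j)).
    apply: eq_bigr => i _; apply: eq_bigr => j _.
    by rewrite !fE (sa (u j)) ?uU //; ring.
  have r1 : \sum_i \sum_j 2 * (f i * a (u i) (u j)) = 4 * (\sum_i f i).
    rewrite mulr_sumr; apply: eq_bigr => i _.
    by rewrite -mulr_sumr -mulr_sumr row; ring.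
  have r2 : \sum_i \sum_j 2 * (f j * a (u j) (u i)) = 4 * (\sum_i f i).
    by rewrite exchange_big /= r1.
  have r3 : \sum_i \sum_j a (u i) (u j) = 40.
    by rewrite (eq_bigr (fun=> 2 * 1)) => [|i _]; rewrite ?row // -mulr_sumr cU1.
  have -> : \sum_i \sum_j (4 * (f i * f j * a (u i) (u j))
      - 2 * (f i * a (u i) (u j)) - 2 * (f j * a (u j) (u i)) + a (u i) (u j)) =
      4 * (\sum_i \sum_j f i * f j * a (u i) (u j))
      - \sum_i \sum_j 2 * (f i * a (u i) (u j)) - \sum_i \sum_j 2 * (f j * a (u j) (u i))
      + \sum_i \sum_j a (u i) (u j).
    rewrite mulr_sumr -!sumrN -!big_split /=; apply: eq_bigr => i _.
    by rewrite mulr_sumr -!sumrN -!big_split.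
  by rewrite r1 r2 r3; ring.
by move: SE; rewrite qE S20; lia.
Qed.

End Obstruction.

(** * Schur products and the norm of a symmetric 4-tensor *)

Section Schur.
Local Open Scope ring_scope.

Definition psd (I : finType) (K : I -> I -> int) :=
  forall c : I -> int, 0 <= \sum_i \sum_j c i * c j * K i j.

Lemma psd1 (I : finType) : psd (fun _ _ : I => 1).
Proof.
move=> c; have -> : \sum_i \sum_j c i * c j * 1 = (\sum_i c i) ^+ 2.
  rewrite expr2 mulr_suml; apply: eq_bigr => i _.
  by rewrite mulr_sumr; apply: eq_bigr => j _; rewrite mulr1.
exact: sqr_ge0.
Qed.

(* The Schur product theorem, for a Gram matrix [G] proportional to a projection. *)
Lemma psd_mul_gram (I T : finType) (K : I -> I -> int) (G : T -> T -> int) (k : int) (f : I -> T) :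
    0 < k -> (forall x y, \sum_z G x z * G y z = k * G x y) ->
  psd K -> psd (fun i j => K i j * G (f i) (f j)).
Proof.
move=> k0 GG pK c; rewrite -(pmulr_rge0 _ k0).
have -> : k * (\sum_i \sum_j c i * c j * (K i j * G (f i) (f j))) =
    \sum_z \sum_i \sum_j (c i * G (f i) z) * (c j * G (f j) z) * K i j.
  rewrite [RHS]exchange_big mulr_sumr /=; apply: eq_bigr => i _.
  rewrite [RHS]exchange_big mulr_sumr /=; apply: eq_bigr => j _.
  have -> : k * (c i * c j * (K i j * G (f i) (f j))) =
    c i * c j * K i j * (k * G (f i) (f j)) by ring.
  by rewrite -GG mulr_sumr; apply: eq_bigr => z _; ring.
by apply: sumr_ge0 => z _; apply: pK.
Qed.

(* Positivity of the norm of the symmetric tensor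
   [\sum_(i, j) w i j (x_i x_i x_j x_j + x_i x_j x_i x_j + x_i x_j x_j x_i)]. *)
Lemma sym_tensor_ge0 (T : finType) (G w : T -> T -> int) (k : int) :
    0 < k -> (forall x y, \sum_z G x z * G y z = k * G x y) ->
  0 <= \sum_i \sum_j \sum_k' \sum_l w i j * w k' l *
    (G i k' * G i k' * (G j l * G j l) + 2 * (G i k' * G i l * (G j k' * G j l))).
Proof.
move=> k0 GG.
(* The index [(i, j, s)] names one of the three pairings [iijj], [ijij], [ijji], and [f1] to [f4]
   read off its four factors. Four Schur products give the Gram matrix of the corresponding
   tensors. *)
pose f1 (u : T * T * 'I_3) := u.1.1.
pose f2 (u : T * T * 'I_3) := if u.2 == 0 then u.1.1 else u.1.2.
pose f3 (u : T * T * 'I_3) := if u.2 == 1 then u.1.1 else u.1.2.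
pose f4 (u : T * T * 'I_3) := if u.2 == 2 then u.1.1 else u.1.2.
have := psd_mul_gram f4 k0 GG (psd_mul_gram f3 k0 GG
  (psd_mul_gram f2 k0 GG (psd_mul_gram f1 k0 GG (@psd1 _)))) (fun u => w u.1.1 u.1.2).
(* The three pairings [s] contribute equally, whence the factor 3. *)
rewrite -(@pmulr_rge0 _ 3 (\sum_i \sum_j \sum_k' \sum_l _)) // => H.
apply: le_trans H _.
rewrite mulr_sumr.
rewrite -(pair_bigA _ (fun ij s => \sum_v w ij.1 ij.2 * w v.1.1 v.1.2 *
  (1 * G (f1 (ij, s)) (f1 v) * G (f2 (ij, s)) (f2 v) * G (f3 (ij, s)) (f3 v) * G (f4 (ij, s)) (f4 v)))) /=.
rewrite -(pair_bigA _ (fun i j => \sum_s \sum_v w i j * w v.1.1 v.1.2 *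
  (1 * G (f1 (i, j, s)) (f1 v) * G (f2 (i, j, s)) (f2 v) * G (f3 (i, j, s)) (f3 v) * G (f4 (i, j, s)) (f4 v)))) /=.
apply: ler_sum => i _; rewrite mulr_sumr; apply: ler_sum => j _; rewrite mulr_sumr.
rewrite (eq_bigr (fun s => \sum_k' \sum_l \sum_s' w i j * w k' l * (1 * G (f1 (i, j, s)) (f1 (k', l, s')) *
   G (f2 (i, j, s)) (f2 (k', l, s')) * G (f3 (i, j, s)) (f3 (k', l, s')) * G (f4 (i, j, s)) (f4 (k', l, s'))))).
  rewrite exchange_big /=; apply: ler_sum => k' _; rewrite exchange_big mulr_sumr /=.
  apply: ler_sum => l _; rewrite !big_ord_recl !big_ord0 /f1 /f2 /f3 /f4 /=.
  by rewrite le_eqVlt; apply/orP; left; apply/eqP; ring.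
by move=> s _; rewrite [RHS]pair_bigA [RHS]pair_bigA; apply: eq_bigr => -[[k' l] s'] _.
Qed.

Section Moments.

Variables (T : finType) (G a d w : T -> T -> int) (k r s t : int).
Hypotheses (k_gt0 : 0 < k) (GG : forall x y, \sum_z G x z * G y z = k * G x y).
Hypotheses (G_sym : forall x y, G x y = G y x) (w_sym : forall x y, w x y = w y x).
Hypothesis sum_d : forall x (f : T -> int), \sum_y d x y * f y = f x.
Hypothesis wE : forall x y, w x y = r * a x y + s * d x y + t.

Variable H : T -> T -> int.
Hypothesis HE : forall x y, G x y * G x y = H x y.

Let H_sym x y : H x y = H y x. Proof. by rewrite -!HE G_sym. Qed.

Let S2 := \sum_i \sum_j \sum_k' \sum_l w i j * w k' l * (G i k' * G i k' * (G j l * G j l)).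
Let S4 := \sum_i \sum_j \sum_k' \sum_l w i j * w k' l * (G i k' * G i l * (G j k' * G j l)).
Let X i j := \sum_k' \sum_l a k' l * (G i k' * G j k') * (G i l * G j l).

Let S2E (W : T -> T -> int) : (forall x y, \sum_z w x z * H y z = W x y) ->
  (forall x y, W x y = W y x) -> S2 = \sum_i \sum_l W i l * W i l.
Proof.
move=> wH W_sym; apply: eq_bigr => i _.
transitivity (\sum_j \sum_l (w i j * H l j) * W i l).
  apply: eq_bigr => j _; rewrite exchange_big /=; apply: eq_bigr => l _.
  rewrite W_sym -wH mulr_sumr; apply: eq_bigr => k' _.
  by rewrite !HE (H_sym l j) (w_sym l k'); ring.
rewrite exchange_big /=; apply: eq_bigr => l _.
by rewrite -mulr_suml wH.
Qed.

Let X_diag : \sum_i X i i = \sum_i \sum_j a i j * (\sum_k' H i k' * H j k').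
Proof.
rewrite /X exchange_big /=; apply: eq_bigr => k' _; rewrite exchange_big /=; apply: eq_bigr => l _.
rewrite mulr_sumr; apply: eq_bigr => i _.
by rewrite !HE (H_sym k') (H_sym l); ring.
Qed.

Let X_tot : \sum_i \sum_j X i j = k * k * (\sum_k' \sum_l a k' l * H k' l).
Proof.
transitivity (\sum_k' \sum_l \sum_i \sum_j a k' l * (G i k' * G j k') * (G i l * G j l)).
  rewrite /X; under eq_bigr do rewrite exchange_big /=.
  rewrite exchange_big /=; apply: eq_bigr => k' _.
  under eq_bigr do rewrite exchange_big /=.
  by rewrite exchange_big.
rewrite mulr_sumr; apply: eq_bigr => k' _; rewrite mulr_sumr; apply: eq_bigr => l _.
transitivity (a k' l * ((k * G k' l) * (k * G k' l))); last by rewrite -HE; ring.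
rewrite -GG mulr_suml mulr_sumr; apply: eq_bigr => i _; rewrite !mulr_sumr; apply: eq_bigr => j _.
by rewrite !(G_sym k') !(G_sym l); ring.
Qed.

Let S4E : S4 = r * (r * (\sum_i \sum_j a i j * X i j) + s * (\sum_i X i i) + t * (\sum_i \sum_j X i j))
  + s * (\sum_i \sum_j w i j * (\sum_k' H i k' * H j k')) + t * (k * k) * (\sum_i \sum_j w i j * H i j).
Proof.
transitivity (\sum_i \sum_j w i j * (r * X i j + s * (\sum_k' H i k' * H j k') + t * (k * k) * H i j)).
  rewrite /S4; apply: eq_bigr => i _; apply: eq_bigr => j _.
  transitivity (w i j * (\sum_k' \sum_l w k' l * (G i k' * G i l * (G j k' * G j l)))).
    rewrite mulr_sumr; apply: eq_bigr => k' _; rewrite mulr_sumr; apply: eq_bigr => l _; ring.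
  congr (_ * _); have -> : t * (k * k) * H i j = t * (k * G i j * (k * G i j)) by rewrite -HE; ring.
  have -> : k * G i j * (k * G i j) = \sum_k' \sum_l (G i k' * G j k') * (G i l * G j l).
    by rewrite -GG mulr_suml; apply: eq_bigr => k' _; rewrite mulr_sumr.
  have -> : \sum_k' H i k' * H j k' = \sum_k' \sum_l d k' l * ((G i k' * G j k') * (G i l * G j l)).
    by apply: eq_bigr => k' _; rewrite sum_d -!HE; ring.
  rewrite /X !mulr_sumr -!big_split /=; apply: eq_bigr => k' _.
  rewrite !mulr_sumr -!big_split /=; apply: eq_bigr => l _.
  by rewrite wE; ring.
have -> : \sum_i X i i = \sum_i \sum_j d i j * X i j by apply: eq_bigr => i _; rewrite sum_d.
have -> : r * (r * (\sum_i \sum_j a i j * X i j) + s * (\sum_i \sum_j d i j * X i j)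
    + t * (\sum_i \sum_j X i j)) = r * (\sum_i \sum_j w i j * X i j).
  congr (_ * _); rewrite !mulr_sumr -!big_split /=; apply: eq_bigr => i _.
  rewrite !mulr_sumr -!big_split /=; apply: eq_bigr => j _.
  by rewrite wE; ring.
rewrite !mulr_sumr -!big_split /=; apply: eq_bigr => i _.
by rewrite !mulr_sumr -!big_split /=; apply: eq_bigr => j _; ring.
Qed.

(** Expanding both occurrences of [w] in the mixed sum isolates [A2], quadratic in [a]. It is the
    one moment that sees adjacency among four vertices at once; in the application the others follow
    from the parameters of the graph. *)
Lemma sym_tensor_moments (W : T -> T -> int) (A1 A2 A3 A4 A5 A6 : int) :
    (forall x y, \sum_z w x z * H y z = W x y) -> (forall x y, W x y = W y x) ->
    \sum_i \sum_l W i l * W i l = A1 ->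
    \sum_i \sum_j a i j * (\sum_k' \sum_l a k' l * (G i k' * G j k') * (G i l * G j l)) = A2 ->
    \sum_i \sum_j a i j * (\sum_k' H i k' * H j k') = A3 ->
    \sum_i \sum_j a i j * H i j = A4 ->
    \sum_i \sum_j w i j * (\sum_k' H i k' * H j k') = A5 ->
    \sum_i \sum_j w i j * H i j = A6 ->
  0 <= A1 + 2 * (r * (r * A2 + s * A3 + t * (k * k * A4)) + s * A5 + t * (k * k) * A6).
Proof.
move=> wH W_sym <- <- <- <- <- <-; rewrite -(S2E wH W_sym) -X_diag -X_tot -S4E.
apply: le_trans (sym_tensor_ge0 w k_gt0 GG) _.
rewrite le_eqVlt; apply/orP; left; apply/eqP.
rewrite /S2 /S4 mulr_sumr -big_split /=; apply: eq_bigr => i _.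
rewrite mulr_sumr -big_split /=; apply: eq_bigr => j _.
rewrite mulr_sumr -big_split /=; apply: eq_bigr => k' _.
by rewrite mulr_sumr -big_split /=; apply: eq_bigr => l _; ring.
Qed.

End Moments.

End Schur.

(** * The strongly regular graph and its Euclidean representation *)

Section Srg.
Local Open Scope ring_scope.

Variables (T : finType) (e : rel T).
Hypothesis e_srg : srg e 76 30 8 14.

Implicit Types (x y z : T) (n m : T -> int).

Let a x y : int := (e x y)%:R.
Let d x y : int := (x == y)%:R.

Lemma sum_natb (P : pred T) : \sum_y (P y)%:R%R = #|P|%:R%R :> int.
Proof.
by rewrite -natr_sum -sum1_card [in RHS]big_mkcond.
Qed.

Lemma sum_d x (f : T -> int) : \sum_y d x y * f y = f x.
Proof.
rewrite (bigD1 x) //= /d eqxx mul1r big1 ?addr0 // => y; rewrite eq_sym => /negbTE ->.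
by rewrite mul0r.
Qed.

Lemma sum_d1 x : \sum_y d x y = 1.
Proof.
by rewrite -[RHS](sum_d x (fun=> 1)); apply: eq_bigr => y _; rewrite mulr1.
Qed.

Lemma sum_1 : \sum_(y : T) 1%R = 76%R :> int.
Proof. by case: e_srg => _ cT _ _ _; rewrite sumr_const cT. Qed.

Lemma a_sym x y : a x y = a y x.
Proof. by case: e_srg => -[_ s] _ _ _ _; rewrite /a s. Qed.

Lemma a_irr x : a x x = 0.
Proof. by case: e_srg => -[i _] _ _ _ _; rewrite /a i. Qed.

Lemma d_sym x y : d x y = d y x. Proof. by rewrite /d eq_sym. Qed.

Lemma d_refl x : d x x = 1. Proof. by rewrite /d eqxx. Qed.

Lemma sum_a x : \sum_y a x y = 30.
Proof.
case: e_srg => _ _ /(_ x) k _ _; rewrite /a sum_natb -k; congr (_%:R).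
by apply: eq_card => y; rewrite !inE.
Qed.

Lemma sum_aa x z : \sum_y a x y * a z y = 16 * d x z - 6 * a x z + 14.
Proof.
have -> : \sum_y a x y * a z y = #|nbhd e x :&: nbhd e z|%:R.
  rewrite (eq_bigr (fun y => (e x y && e z y)%:R)).
    by rewrite sum_natb; congr (_%:R); apply: eq_card => y; rewrite !inE.
  by move=> y _; rewrite /a; case: (e x y); case: (e z y).
case: e_srg => -[i s] _ k l m; rewrite /d /a; case: eqVneq => [->|xz] /=.
  by rewrite setIid k i.
by case: (boolP (e x z)) => exz; rewrite ?(l _ _ exz) ?(m _ _ xz exz).
Qed.

(** This says that [A n + 8 n] is constant, that is, that [n] is a constant plus an eigenvector for
    -8. *)
Definition good n := forall x, 2 * (\sum_y a x y * n y) + 16 * n x = \sum_y n y.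

Lemma good_lin n m (s t u : int) :
  good n -> good m -> good (fun y => s * n y + t * m y + u).
Proof.
move=> gn gm x.
have -> : \sum_y a x y * (s * n y + t * m y + u) =
    s * (\sum_y a x y * n y) + t * (\sum_y a x y * m y) + u * (\sum_y a x y).
  by rewrite !mulr_sumr -!big_split /=; apply: eq_bigr => y _; ring.
have -> : \sum_y (s * n y + t * m y + u) =
    s * (\sum_y n y) + t * (\sum_y m y) + u * (\sum_(y : T) 1).
  by rewrite !mulr_sumr -!big_split /=; apply: eq_bigr => y _; ring.
by rewrite sum_a sum_1 -(gn x) -(gm x); ring.
Qed.

(** The matrix [2 I - A + 3 J] kills the eigenspace of 2 and is 10 on that of -8 and 200 on the
    constants, hence is a Gram matrix of rank 19. *)
Let g x y : int := 2 * d x y - a x y + 3.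

Lemma g_sym x y : g x y = g y x.
Proof. by rewrite /g a_sym d_sym. Qed.

Lemma sum_g_mul x n :
  \sum_y g x y * n y = 2 * n x - (\sum_y a x y * n y) + 3 * (\sum_y n y).
Proof.
rewrite -(sum_d x n) /g !mulr_sumr -sumrN -!big_split /=.
by apply: eq_bigr => y _; ring.
Qed.

Lemma sum_g x : \sum_y g x y = 200.
Proof.
have -> : \sum_y g x y = \sum_y g x y * 1 by apply: eq_bigr => y _; rewrite mulr1.
rewrite (sum_g_mul x (fun=> 1)) sum_1.
by under eq_bigr do rewrite mulr1; rewrite sum_a.
Qed.

Lemma good_g x : good (g x).
Proof.
move=> z; rewrite sum_g.
have -> : \sum_y a z y * g x y = \sum_y g x y * a z y.
  by apply: eq_bigr => y _; ring.
rewrite sum_g_mul sum_a sum_aa /g (a_sym z x); ring.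
Qed.

(* [g x] reproduces good functions: good functions are the inner products with a fixed
   vector of the 19-dimensional Euclidean space carrying the Gram matrix [g]. *)
Lemma good_repr n x : good n ->
  2 * (\sum_y g x y * n y) = 20 * n x + 5 * (\sum_y n y).
Proof. by move=> gn; rewrite sum_g_mul -(gn x); ring. Qed.

Lemma good_comb (c : T -> int) (u : int) : good (fun y => (\sum_x c x * g x y) + u).
Proof.
move=> z.
have -> : \sum_y a z y * (\sum_x c x * g x y + u) =
    (\sum_x c x * (\sum_y a z y * g x y)) + u * (\sum_y a z y).
  under [X in _ = X + _]eq_bigr do rewrite mulr_sumr.
  rewrite exchange_big mulr_sumr -big_split /=.
  apply: eq_bigr => y _; rewrite mulrDr mulr_sumr (mulrC u); congr (_ + _).
  by apply: eq_bigr => x _; ring.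
have -> : \sum_y (\sum_x c x * g x y + u) = \sum_x c x * 200 + u * 76.
  rewrite big_split /= -sum_1 mulr_sumr; congr (_ + _); last first.
    by apply: eq_bigr => y _; rewrite mulr1.
  rewrite exchange_big /=; apply: eq_bigr => x _.
  by rewrite -mulr_sumr sum_g.
have -> : \sum_x c x * 200 = \sum_x (2 * (c x * (\sum_y a z y * g x y)) + 16 * (c x * g x z)).
  by apply: eq_bigr => x _; rewrite -(sum_g x) -(good_g x z); ring.
by rewrite big_split /= -!mulr_sumr sum_a; ring.
Qed.

Lemma sum_comb (c : T -> int) (u : int) :
  \sum_y ((\sum_x c x * g x y) + u) = 200 * (\sum_x c x) + 76 * u.
Proof.
rewrite big_split /= exchange_big /= -[u in \sum_(y : T) u]mulr1 -mulr_sumr sum_1.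
rewrite mulr_sumr (mulrC u); congr (_ + _); apply: eq_bigr => x _.
by rewrite -mulr_sumr sum_g mulrC.
Qed.

(** The inner product of [sum c_x x] with the vector encoded by [n] is [sum c_x n(x)], so a sum over
    all vertices reduces to values of [n] on the support of [c]. The norms needed later are computed
    in this way. *)
Lemma sum_comb_mul (c : T -> int) (u : int) n : good n ->
  2 * (\sum_y ((\sum_x c x * g x y) + u) * n y) =
  20 * (\sum_x c x * n x) + 5 * (\sum_x c x) * (\sum_y n y) + 2 * u * (\sum_y n y).
Proof.
move=> gn.
have -> : \sum_y ((\sum_x c x * g x y) + u) * n y =
    \sum_x c x * (\sum_y g x y * n y) + u * (\sum_y n y).
  rewrite (eq_bigr (fun y => (\sum_x c x * (g x y * n y)) + u * n y)); last first.
    by move=> y _; rewrite mulrDl mulr_suml; congr (_ + _); apply: eq_bigr => x _; ring.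
  rewrite big_split /= -mulr_sumr exchange_big /=; congr (_ + _).
  by apply: eq_bigr => x _; rewrite mulr_sumr.
rewrite mulrDr mulr_sumr (eq_bigr (fun x => 20 * (c x * n x) + 5 * (\sum_y n y) * c x)).
  by rewrite big_split /= -!mulr_sumr; ring.
by move=> x _; rewrite mulrCA good_repr //; ring.
Qed.

(* [n] is the indicator function of the set of vertices having exactly one neighbour in the
   4-clique, the clique included. *)
Lemma clique_good (x1 x2 x3 x4 : T) :
    e x1 x2 -> e x1 x3 -> e x1 x4 -> e x2 x3 -> e x2 x4 -> e x3 x4 ->
  exists n, [/\ good n, \sum_y n y = 40 & forall y, n y * n y = n y].
Proof.
move=> e12 e13 e14 e23 e24 e34.
pose c y := d x1 y + d x2 y + d x3 y + d x4 y.
have cE (f : T -> int) : \sum_y c y * f y = f x1 + f x2 + f x3 + f x4.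
  rewrite -(sum_d x1 f) -(sum_d x2 f) -(sum_d x3 f) -(sum_d x4 f) -!big_split /=.
  by apply: eq_bigr => y _; rewrite /c; ring.
have c1 : \sum_y c y = 4.
  by transitivity (\sum_y c y * 1); [apply: eq_bigr => y _; rewrite mulr1 | rewrite cE].
(* A vertex outside the clique with [j] neighbours in it gets [12 - j - 10 = 2 - j], a clique vertex
   gets [5 + 6 - 10 = 1]. *)
pose n y := (\sum_x c x * g x y) - 10.
have gn : good n := good_comb c (- 10).
have sn : \sum_y n y = 40 by rewrite sum_comb c1.
have gadj x y : e x y -> g x y = 2.
  by move=> exy; rewrite /g /a /d exy; case: eqVneq exy => [->|//]; case: e_srg => -[->].
have grefl x : g x x = 5 by rewrite /g a_irr d_refl.
have [n1 n2 n3 n4] : [/\ n x1 = 1, n x2 = 1, n x3 = 1 & n x4 = 1].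
  rewrite /n !cE !grefl !gadj //; by case: e_srg => -[_ ->].
have snn : \sum_y (n y * n y - n y) <= 0.
  rewrite big_split /= sumrN sn.
  have := sum_comb_mul c (- 10) gn; rewrite cE n1 n2 n3 n4 c1 sn.
  rewrite -[X in 2 * X = _]/(\sum_y n y * n y); move: (\sum_y _) => ?; lia.
exists n; split=> // y; apply/eqP; rewrite -subr_eq0; move: snn.
have p (z : T) : true -> 0 <= n z * n z - n z by case: (leP 1 (n z)) => h _; [|have {}h : n z <= 0 by lia]; nia.
move=> h; have : \sum_y (n y * n y - n y) == 0 by rewrite eq_le h sumr_ge0.
by rewrite psumr_eq0 // => /allP /(_ y (mem_index_enum y)).
Qed.

Lemma eq_good n m : n =1 m -> good n -> good m.
Proof.
move=> E gn x; rewrite -E.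
have -> : \sum_y m y = \sum_y n y by apply: eq_bigr => y _; rewrite E.
by rewrite -(gn x); congr (2 * _ + _); apply: eq_bigr => y _; rewrite E.
Qed.

Lemma a_idem x y : a x y * a x y = a x y.
Proof. by rewrite /a; case: (e x y). Qed.

Lemma g_refl x : g x x = 5.
Proof. by rewrite /g a_irr d_refl. Qed.

Lemma e_neq x y : e x y -> d x y = 0.
Proof. by rewrite /d; case: eqVneq => [->|//]; case: e_srg => -[->]. Qed.

Lemma g_adj x y : e x y -> g x y = 2.
Proof. by move=> exy; rewrite /g /a exy e_neq. Qed.

Lemma int_sq_ge (i : int) : 0 <= i * i - i.
Proof. by case: (leP 1 i) => h; [|have {}h : i <= 0 by lia]; nia. Qed.

Lemma int_shifted_sq (i : int) : (i - 1) * (i - 2) != 0 -> (i - 1) * (i - 2) <= 2 -> i = 0 \/ i = 3.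
Proof.
move=> /eqP i0 i2.
have h1 : 0 <= i by rewrite leNgt; apply/negP => h; nia.
have h2 : i <= 3 by rewrite leNgt; apply/negP => h; nia.
have [->|[E|[E|->]]] : i = 0 \/ i = 1 \/ i = 2 \/ i = 3 by lia.
- by left.
- by rewrite E in i0.
- by rewrite E in i0.
- by right.
Qed.

Lemma sum_idem n : \sum_y n y * n y = \sum_y n y -> forall y, n y * n y = n y.
Proof.
move=> E y; apply/eqP; rewrite -subr_eq0.
have : \sum_y (n y * n y - n y) == 0 by rewrite big_split /= sumrN E subrr.
rewrite psumr_eq0 => [/allP /(_ y (mem_index_enum y)) //|z _]; exact: int_sq_ge.
Qed.

Lemma n01 n : (forall x, n x * n x = n x) -> forall x, n x = 0 \/ n x = 1.
Proof.
move=> nn x; have /eqP := nn x; rewrite -subr_eq0 -[X in _ - X]mulr1 -mulrBr mulf_eq0 subr_eq0.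
by case/orP => /eqP; [left | right].
Qed.

Lemma a01 x y : a x y = 0 \/ a x y = 1.
Proof. by rewrite /a; case: (e x y); [right | left]. Qed.

Lemma a_d x y : a x y * d x y = 0.
Proof. by rewrite /a; case E: (e x y); rewrite ?mul0r // e_neq. Qed.

Lemma sum_aa_edge x y : \sum_z a x z * a y z * a x y = 8 * a x y.
Proof.
rewrite -mulr_suml sum_aa.
have -> : (16 * d x y - 6 * a x y + 14) * a x y =
  16 * (a x y * d x y) - 6 * (a x y * a x y) + 14 * a x y by ring.
by rewrite a_d a_idem; ring.
Qed.

(* In the Euclidean representation [F] is a vector of norm 3 whose inner products with the
   vertices are 1 or 2 with exactly one exception; adding it to the exceptional vertex or
   subtracting it yields the two short vectors. *)
Lemma triangle_dichotomy n (x y z : T) :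
    good n -> \sum_u n u = 40 -> (forall u, n u * n u = n u) ->
    e x y -> e x z -> e y z -> n x = 0 -> n y = 0 -> n z = 0 ->
  (exists m, [/\ good m, \sum_u m u = 16 & \sum_u m u * m u = 16]) \/
  (exists m, [/\ good m, \sum_u m u = 80 & \sum_u m u * m u = 100]).
Proof.
move=> gn sn nn exy exz eyz nx ny nz.
pose F u := 10 - g x u - g y u - g z u - n u.
have gF : good F.
  apply: (eq_good _ (good_lin 1 1 10 (good_lin (-1) (-1) 0 (good_g x) (good_g y))
     (good_lin (-1) (-1) 0 (good_g z) gn))) => u.
  by rewrite /F; ring.
have FM m : good m -> 2 * (\sum_u F u * m u) =
    5 * (\sum_u m u) - 20 * (m x + m y + m z) - 2 * (\sum_u n u * m u).
  move=> gm; have -> : \sum_u F u * m u = 10 * (\sum_u m u) - \sum_u g x u * m u -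
      \sum_u g y u * m u - \sum_u g z u * m u - \sum_u n u * m u.
    by rewrite mulr_sumr -!sumrN -!big_split /=; apply: eq_bigr => u _; rewrite /F; ring.
  by rewrite !mulrBr !good_repr //; ring.
have sF : \sum_u F u = 120.
  have -> : \sum_u F u = 10 * (\sum_(u : T) 1) - \sum_u g x u - \sum_u g y u -
      \sum_u g z u - \sum_u n u.
    by rewrite mulr_sumr -!sumrN -!big_split /=; apply: eq_bigr => u _; rewrite /F; ring.
  by rewrite !sum_g sn sum_1.
have snn : \sum_u n u * n u = 40 by rewrite (eq_bigr n).
have ge u v : e u v -> g v u = 2 by move=> ?; rewrite g_sym g_adj.
have [Fx Fy Fz] : [/\ F x = 1, F y = 1 & F z = 1].
  by rewrite /F !g_refl nx ny nz !(g_adj exy, g_adj exz, g_adj eyz, ge _ _ exy, ge _ _ exz, ge _ _ eyz).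
have sFn := FM n gn; have sFF := FM F gF.
have {}sFF : \sum_u F u * F u = 210.
  rewrite (_ : \sum_u n u * F u = \sum_u F u * n u) in sFF; last first.
    by apply: eq_bigr => u _; rewrite mulrC.
  move: sFn sFF; rewrite sF Fx Fy Fz sn snn nx ny nz.
  move: (\sum_u F u * F u) (\sum_u F u * n u) => s t; lia.
have s2 : \sum_u (F u - 1) * (F u - 2) = 2.
  have -> : \sum_u (F u - 1) * (F u - 2) = \sum_u F u * F u - 3 * (\sum_u F u) + 2 * (\sum_(u : T) 1).
    by rewrite !mulr_sumr -sumrN -!big_split /=; apply: eq_bigr => u _; ring.
  by rewrite sFF sF sum_1.
have F12 u : 0 <= (F u - 1) * (F u - 2).
  have -> : (F u - 1) * (F u - 2) = (F u - 1) * (F u - 1) - (F u - 1) by ring.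
  exact: int_sq_ge.
have [q F03] : exists q, F q = 0 \/ F q = 3.
  have [q Fq] : exists q, (F q - 1) * (F q - 2) != 0.
    apply/existsP; apply: contraT; rewrite negb_exists => /forallP H; move: s2.
    by rewrite big1 // => u _; apply/eqP; have := H u; rewrite negbK.
  exists q; apply: int_shifted_sq Fq _.
  by rewrite -[X in _ <= X]s2 (bigD1 q) //= lerDl sumr_ge0.
have gq := good_repr q gF.
have gqq : \sum_u g q u * g q u = 550.
  have := good_repr q (good_g q); rewrite g_refl sum_g; move: (\sum_u _) => s; lia.
(* If [F q = 0], the function of [q + F] lowered by 4 has equal sum and sum of squares. If
   [F q = 3], the vector [q - F] has norm [5 + 3 - 6 = 2]. *)
have [F0 | F3] := F03.
- left; exists (fun u => 1 * g q u + 1 * F u + (- 4)); split.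
  + exact: good_lin (good_g q) gF.
  + have -> : \sum_u (1 * g q u + 1 * F u + -4) = \sum_u g q u + \sum_u F u - 4 * (\sum_(u : T) 1).
      by rewrite mulr_sumr -sumrN -!big_split /=; apply: eq_bigr => u _; ring.
    by rewrite sum_g sF sum_1.
  + have -> : \sum_u (1 * g q u + 1 * F u + -4) * (1 * g q u + 1 * F u + -4) =
       \sum_u g q u * g q u + \sum_u F u * F u + 2 * (\sum_u g q u * F u)
       - 8 * (\sum_u g q u) - 8 * (\sum_u F u) + 16 * (\sum_(u : T) 1).
      by rewrite !mulr_sumr -!sumrN -!big_split /=; apply: eq_bigr => u _; ring.
    by rewrite gq F0 gqq sFF sum_g sF sum_1.
- right; exists (fun u => 1 * g q u + (- 1) * F u + 0); split.
  + exact: good_lin (good_g q) gF.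
  + have -> : \sum_u (1 * g q u + -1 * F u + 0) = \sum_u g q u - \sum_u F u.
      by rewrite -sumrN -!big_split /=; apply: eq_bigr => u _; ring.
    by rewrite sum_g sF.
  + have -> : \sum_u (1 * g q u + -1 * F u + 0) * (1 * g q u + -1 * F u + 0) =
       \sum_u g q u * g q u + \sum_u F u * F u - 2 * (\sum_u g q u * F u).
      by rewrite !mulr_sumr -!sumrN -!big_split /=; apply: eq_bigr => u _; ring.
    by rewrite gq F3 gqq sFF sF.
Qed.

(** * Existence of a 4-clique *)

Section NoClique.

Hypothesis no_clique : forall x y u v, e x y -> e x u -> e x v -> e y u -> e y v -> e u v -> False.

(** The Bose-Mesner algebra of the graph, spanned by [I], [A] and [J]; [bm_sum] and [bm_mul] give
    its matrix and entrywise products. *)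
Let bm (r s t : int) x y := r * d x y + s * a x y + t.

Let bm_sum (r s t r' s' t' : int) x y : \sum_z bm r s t x z * bm r' s' t' y z =
  bm (r * r' + 16 * (s * s')) (r * s' + s * r' - 6 * (s * s'))
     (14 * (s * s') + r * t' + t * r' + 30 * (s * t') + 30 * (t * s') + 76 * (t * t')) x y.
Proof.
transitivity (r * r' * (\sum_z d x z * d y z) + r * s' * (\sum_z d x z * a y z)
  + s * r' * (\sum_z d y z * a x z) + s * s' * (\sum_z a x z * a y z)
  + r * t' * (\sum_z d x z) + t * r' * (\sum_z d y z)
  + s * t' * (\sum_z a x z) + t * s' * (\sum_z a y z) + t * t' * (\sum_(z : T) 1)).
  by rewrite !mulr_sumr -!big_split /=; apply: eq_bigr => z _; rewrite /bm; ring.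
rewrite !sum_d !sum_d1 !sum_a sum_aa sum_1 (d_sym y) (a_sym y) /bm.
ring.
Qed.

Let d_idem x y : d x y * d x y = d x y.
Proof. by rewrite /d; case: (x == y). Qed.

Let bm_mul (r s t r' s' t' : int) x y : bm r s t x y * bm r' s' t' x y =
  bm (r * r' + r * t' + t * r') (s * s' + s * t' + t * s') (t * t') x y.
Proof.
rewrite /bm; transitivity (r * r' * (d x y * d x y) + s * s' * (a x y * a x y)
  + (r * s' + s * r') * (a x y * d x y)
  + (r * t' + t * r') * d x y + (s * t' + t * s') * a x y + t * t'); first by ring.
by rewrite d_idem a_idem a_d; ring.
Qed.

Let bm_tot (r s t : int) : \sum_x \sum_y bm r s t x y = 76 * (r + 30 * s + 76 * t).
Proof.
rewrite (eq_bigr (fun=> (r + 30 * s + 76 * t) * 1)) => [|x _].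
  by rewrite -mulr_sumr sum_1 mulrC.
transitivity (r * (\sum_y d x y) + s * (\sum_y a x y) + t * (\sum_(y : T) 1)).
  by rewrite !mulr_sumr -!big_split /=; apply: eq_bigr => y _; rewrite /bm; ring.
by rewrite sum_d1 sum_a sum_1; ring.
Qed.

Let bm_sym (r s t : int) x y : bm r s t x y = bm r s t y x.
Proof. by rewrite /bm d_sym a_sym. Qed.

(** This matrix is 190 times the projection onto the eigenspace of -8: [38 I - 19 A + 7 J] vanishes
    on the constants and on the eigenspace of 2. *)
Let G := bm 38 (- 19) 7.

Let GE x y : G x y = 38 * d x y - 19 * a x y + 7.
Proof. by rewrite /G /bm; ring. Qed.

(** The common neighbours of the ends of an edge form a coclique when there is no 4-clique. Every
    other count that enters depends only on the parameters, so the value is the same for all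
    edges. *)
Let edge_sum i j : a i j = 1 ->
  \sum_k \sum_l a k l * (G i k * G j k) * (G i l * G j l) = 361 * (8 * (684 - 2254)) - 342 * 2304 + 2128 * 1080 + 2254 * 2280.
Proof.
move=> aij; have dij : d i j = 0 by have := a_d i j; rewrite aij mul1r.
pose c k := a i k * a j k; pose de k := d i k + d j k; pose al k := a i k + a j k.
pose v k := 361 * c k - 456 * de k - 133 * al k + 49.
have da x y k : a x y = 1 -> d x k * a y k = d x k.
  by move=> axy; rewrite /d; case: eqVneq => [<-|]; rewrite ?mul0r // a_sym axy.
have dd k : d i k * d j k = 0.
  by rewrite /d; case: eqVneq => [<-|_]; rewrite ?mul0r // -/(d j i) d_sym dij mulr0.
have aji : a j i = 1 by rewrite a_sym.
have vE k : G i k * G j k = v k.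
  transitivity (1444 * (d i k * d j k) - 722 * (d i k * a j k) - 722 * (d j k * a i k)
    + 361 * c k + 266 * de k - 133 * al k + 49); first by rewrite !GE /c /de /al; ring.
  by rewrite dd !da // /v /de; ring.
have sc : \sum_k c k = 8 by rewrite sum_aa dij aij.
have sde : \sum_k de k = 2 by rewrite big_split /= !sum_d1.
have sal : \sum_k al k = 60 by rewrite big_split /= !sum_a.
have cal k : c k * al k = 2 * c k.
  transitivity ((a i k * a i k) * a j k + a i k * (a j k * a j k)); first by rewrite /c /al; ring.
  by rewrite !a_idem /c; ring.
have cde k : c k * de k = 0.
  transitivity ((a i k * d i k) * a j k + a i k * (a j k * d j k)); first by rewrite /c /de; ring.
  by rewrite !a_d; ring.
have alal k : al k * al k = al k + 2 * c k.
  transitivity (a i k * a i k + a j k * a j k + 2 * c k); first by rewrite /c /al; ring.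
  by rewrite !a_idem.
have dal k : de k * al k = de k.
  transitivity (a i k * d i k + a j k * d j k + d i k * a j k + d j k * a i k).
    by rewrite /al /de; ring.
  by rewrite !a_d !da // /de; ring.
have dede k : de k * de k = de k.
  transitivity (d i k * d i k + d j k * d j k + 2 * (d i k * d j k)); first by rewrite /de; ring.
  by rewrite !d_idem dd /de; ring.
(* Adjacent common neighbours of [i] and [j] would complete a 4-clique. *)
have cac k l : c k * c l * a k l = 0.
  rewrite /c; have [->|eik] := a01 i k; first by ring.
  have [->|ejk] := a01 j k; first by ring.
  have [->|eil] := a01 i l; first by ring.
  have [->|ejl] := a01 j l; first by ring.
  have [->|ekl] := a01 k l; first by ring.
  have e1 x y : a x y = 1 -> e x y by rewrite /a; case: (e x y).
  by case: (no_clique (e1 _ _ aij) (e1 _ _ eik) (e1 _ _ eil) (e1 _ _ ejk) (e1 _ _ ejl) (e1 _ _ ekl)).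
have Ade k : \sum_l a k l * de l = al k.
  have -> : \sum_l a k l * de l = \sum_l d i l * a k l + \sum_l d j l * a k l.
    by rewrite -big_split /=; apply: eq_bigr => l _; rewrite /de; ring.
  by rewrite !sum_d !(a_sym k).
have Aal k : \sum_l a k l * al l = 16 * de k - 6 * al k + 28.
  have -> : \sum_l a k l * al l = \sum_l a i l * a k l + \sum_l a j l * a k l.
    by rewrite -big_split /=; apply: eq_bigr => l _; rewrite /al; ring.
  by rewrite !sum_aa /de /al; ring.
have Av k : \sum_l a k l * v l = 361 * (\sum_l a k l * c l) + 342 * al k - 2128 * de k - 2254.
  transitivity (361 * (\sum_l a k l * c l) - 456 * (\sum_l a k l * de l)
      - 133 * (\sum_l a k l * al l) + 49 * (\sum_l a k l)).
    by rewrite !mulr_sumr -!sumrN -!big_split /=; apply: eq_bigr => l _; rewrite /v; ring.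
  by rewrite Ade Aal sum_a; ring.
have lin (f : T -> int) : \sum_k v k * f k = 361 * (\sum_k c k * f k) - 456 * (\sum_k de k * f k)
    - 133 * (\sum_k al k * f k) + 49 * (\sum_k f k).
  by rewrite !mulr_sumr -!sumrN -!big_split /=; apply: eq_bigr => k _; rewrite /v; ring.
have XE : \sum_k \sum_l a k l * (G i k * G j k) * (G i l * G j l) = \sum_k v k * (\sum_l a k l * v l).
  apply: eq_bigr => k _; rewrite mulr_sumr; apply: eq_bigr => l _.
  by rewrite !vE; ring.
have vAc : \sum_k v k * (\sum_l a k l * c l) = 8 * (684 - 2254).
  transitivity (\sum_l c l * (\sum_k a l k * v k)).
    rewrite (eq_bigr (fun k => \sum_l c l * (a l k * v k))).
      by rewrite exchange_big /=; apply: eq_bigr => l _; rewrite mulr_sumr.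
    by move=> k _; rewrite mulr_sumr; apply: eq_bigr => l _; rewrite (a_sym k); ring.
  transitivity (\sum_l (684 - 2254) * c l); last by rewrite -mulr_sumr sc mulrC.
  apply: eq_bigr => l _; rewrite Av.
  transitivity (361 * (\sum_k c l * c k * a l k) + 342 * (c l * al l) - 2128 * (c l * de l) - 2254 * c l).
    have -> : \sum_k c l * c k * a l k = c l * (\sum_k a l k * c k).
      by rewrite mulr_sumr; apply: eq_bigr => k _; ring.
    ring.
  by rewrite cal cde big1 => [|k _]; [ring | exact: cac].
rewrite XE; transitivity (361 * (\sum_k v k * (\sum_l a k l * c l)) + 342 * (\sum_k v k * al k)
    - 2128 * (\sum_k v k * de k) - 2254 * (\sum_k v k)).
  rewrite !mulr_sumr -!sumrN -!big_split /=; apply: eq_bigr => k _.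
  by rewrite Av; ring.
have va : \sum_k v k * al k = - 2304.
  rewrite lin (eq_bigr _ (fun k _ => cal k)) -mulr_sumr sc (eq_bigr _ (fun k _ => dal k)) sde.
  by rewrite (eq_bigr _ (fun k _ => alal k)) big_split /= -mulr_sumr sc sal.
have vd : \sum_k v k * de k = - 1080.
  rewrite lin (eq_bigr _ (fun k _ => cde k)) big1 // (eq_bigr _ (fun k _ => dede k)) sde.
  by rewrite (eq_bigr de) ?sde // => k _; rewrite mulrC dal.
have v1 : \sum_k v k = - 2280.
  transitivity (361 * (\sum_k c k) - 456 * (\sum_k de k) - 133 * (\sum_k al k) + 49 * (\sum_(k : T) 1)).
    by rewrite !mulr_sumr -!sumrN -!big_split /=; apply: eq_bigr => k _; rewrite /v; ring.
  by rewrite sc sde sal sum_1.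
by rewrite vAc va vd v1; ring.
Qed.

Let H := bm 1976 95 49.
(* Up to rounding, these weights minimize the norm of the tensor. *)
Let w := bm (- 6) 3 (- 1).

Lemma clique_free_false : False.
Proof.
have GG x y : \sum_z G x z * G y z = 190 * G x y.
  by rewrite /G bm_sum /bm; ring.
have HE x y : G x y * G x y = H x y.
  by rewrite /G /H bm_mul /bm; ring.
have wE x y : w x y = 3 * a x y + (- 6) * d x y + (- 1).
  by rewrite /w /bm; ring.
have wH x y : \sum_z w x z * H y z = bm (- 7296) 3648 (- 444) x y.
  by rewrite /w /H bm_sum /bm; ring.
have aE x y : a x y = bm 0 1 0 x y by rewrite /bm; ring.
have ss (r s t : int) : \sum_i \sum_j bm r s t i j * bm r s t i j =
    76 * ((r + t) * (r + t) + 30 * ((s + t) * (s + t)) + 45 * (t * t)).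
  rewrite (eq_bigr (fun i => \sum_j bm (r * r + 2 * r * t) (s * s + 2 * s * t) (t * t) i j)) ?bm_tot => [|i _].
    by ring.
  by apply: eq_bigr => j _; rewrite bm_mul /bm; ring.
have aY (r s t : int) (f : T -> T -> int) : (forall i j, f i j = bm r s t i j) ->
    \sum_i \sum_j a i j * f i j = 76 * 30 * (s + t).
  move=> fE; rewrite (eq_bigr (fun i => \sum_j bm 0 (s + t) 0 i j)) ?bm_tot => [|i _]; first by ring.
  by apply: eq_bigr => j _; rewrite fE aE bm_mul /bm; ring.
have wY (r s t : int) (f : T -> T -> int) : (forall i j, f i j = bm r s t i j) ->
    \sum_i \sum_j w i j * f i j = 76 * (- 7 * r + 60 * s + 8 * t).
  move=> fE.
  rewrite (eq_bigr (fun i => \sum_j bm (- 7 * r - 6 * t) (2 * s + 3 * t) (- t) i j)) ?bm_tot => [|i _].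
    by ring.
  by apply: eq_bigr => j _; rewrite fE /w bm_mul /bm; ring.
have aX (Y : T -> T -> int) c : (forall i j, a i j = 1 -> Y i j = c) ->
    \sum_i \sum_j a i j * Y i j = 76 * 30 * c.
  move=> Yc; transitivity (c * (\sum_i \sum_j bm 0 1 0 i j)); last by rewrite bm_tot; ring.
  rewrite mulr_sumr; apply: eq_bigr => i _; rewrite mulr_sumr; apply: eq_bigr => j _.
  rewrite -aE; have [-> | aij] := a01 i j; first by rewrite mul0r mulr0.
  by rewrite Yc // aij mulr1 mul1r.
(* All moments are now explicit, and they make the norm of the tensor negative. *)
have := @sym_tensor_moments T G a d w 190 3 (- 6) (- 1) isT GG (bm_sym _ _ _) (bm_sym _ _ _)
  sum_d wE H HE _ _ _ _ _ _ _ wH (bm_sym _ _ _) (ss _ _ _) (aX _ _ edge_sum)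
  (aY _ _ _ _ (bm_sum _ _ _ _ _ _)) (aY _ _ _ _ (fun _ _ => erefl))
  (wY _ _ _ _ (bm_sum _ _ _ _ _ _)) (wY _ _ _ _ (fun _ _ => erefl)).
lia.
Qed.

End NoClique.

(** * The triangle-free case *)

Section TriangleFree.

Variable n : T -> int.
Hypotheses (gn : good n) (sn : \sum_x n x = 40) (nn : forall x, n x * n x = n x).
Hypothesis no_triangle : forall x y z,
  e x y -> e x z -> e y z -> n x = 0 -> n y = 0 -> n z = 0 -> False.

Let n_neq x y : n x = 0 -> n y = 1 -> d x y = 0.
Proof. by move=> nx ny; rewrite /d; case: eqVneq => [E|//]; rewrite E ny in nx. Qed.

Let an x : \sum_y a x y * n y = 20 - 8 * n x.
Proof. have := gn x; rewrite sn; move: (\sum_y _) => s; lia. Qed.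

Let t x := 1 - n x.

Let aaat x y z : a x y * a x z * a y z * t x * t y * t z = 0.
Proof.
rewrite /t; have [nx | ->] := n01 nn x; last by ring.
have [ny | ->] := n01 nn y; last by ring.
have [nz | ->] := n01 nn z; last by ring.
rewrite /a; case exy: (e x y); last by rewrite !(mulr0n, mul0r, mulr0).
case exz: (e x z); last by rewrite !(mulr0n, mul0r, mulr0).
case eyz: (e y z); last by rewrite !(mulr0n, mul0r, mulr0).
by case: (no_triangle exy exz eyz nx ny nz).
Qed.

(** Ordered triangles, weighted at their three vertices; [W] below does the same for edges. A weight
    equal to 1 can be summed out, each edge lying in 8 triangles. *)
Let R (f1 f2 f3 : T -> int) :=
  \sum_x \sum_y \sum_z a x y * a x z * a y z * (f1 x * f2 y * f3 z).

Let W (f1 f2 : T -> int) := \sum_x \sum_y a x y * (f1 x * f2 y).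

Let R3 f1 f2 : R f1 f2 (fun=> 1) = 8 * W f1 f2.
Proof.
rewrite /R /W mulr_sumr; apply: eq_bigr => x _; rewrite mulr_sumr; apply: eq_bigr => y _.
have -> : 8 * (a x y * (f1 x * f2 y)) = 8 * a x y * (f1 x * f2 y) by ring.
by rewrite -sum_aa_edge mulr_suml; apply: eq_bigr => z _; ring.
Qed.

Let R2 f1 f3 : R f1 (fun=> 1) f3 = 8 * W f1 f3.
Proof.
rewrite -R3 /R; apply: eq_bigr => x _; rewrite exchange_big /=; apply: eq_bigr => z _.
by apply: eq_bigr => y _; rewrite (a_sym z y); ring.
Qed.

Let R1 f2 f3 : R (fun=> 1) f2 f3 = 8 * W f2 f3.
Proof.
rewrite -R2 /R exchange_big /=; apply: eq_bigr => y _; apply: eq_bigr => x _.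
by apply: eq_bigr => z _; rewrite (a_sym y x); ring.
Qed.

Let sum_nt f : \sum_x f x * n x + \sum_x f x * t x = \sum_x f x.
Proof. by rewrite -big_split /=; apply: eq_bigr => x _; rewrite /t; ring. Qed.

Let WE f2 (b c : int) f1 : (forall x, f1 x * (\sum_y a x y * f2 y) = b * f1 x) ->
  \sum_x f1 x = c -> W f1 f2 = b * c.
Proof.
move=> H <-; rewrite /W mulr_sumr; apply: eq_bigr => x _; rewrite -H mulr_sumr.
by apply: eq_bigr => y _; ring.
Qed.

Let at_ x : \sum_y a x y * t y = 10 + 8 * n x.
Proof. have := sum_nt (a x); rewrite an sum_a; move: (\sum_y _) => s; lia. Qed.

Let st : \sum_x t x = 36.
Proof. by rewrite big_split /= sumrN sn sum_1. Qed.

(** Substituting [n = 1 - t] one weight at a time leaves edge counts and [R t t t], which is 0 by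
    triangle-freeness: [8 (480 - 720 + 360) = 960]. *)
Let Rnnn : R n n n = 960.
Proof.
have Rttt : R t t t = 0.
  rewrite /R big1 // => x _; rewrite big1 // => y _; rewrite big1 // => z _.
  by rewrite -[RHS](aaat x y z); ring.
have Wnn : W n n = 480.
  by rewrite (WE (b := 12) _ sn) // => x; rewrite an; have [->|->] := n01 nn x.
have Wnt : W n t = 720.
  by rewrite (WE (b := 18) _ sn) // => x; rewrite at_; have [->|->] := n01 nn x.
have Wtt : W t t = 360.
  by rewrite (WE (b := 10) _ st) // => x; rewrite at_ /t; have [->|->] := n01 nn x.
have E3 : R n n n = R n n (fun=> 1) - R n n t.
  rewrite /R -sumrN -big_split /=; apply: eq_bigr => x _; rewrite -sumrN -big_split /=.
  by apply: eq_bigr => y _; rewrite -sumrN -big_split /=; apply: eq_bigr => z _; rewrite /t; ring.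
have E2 : R n n t = R n (fun=> 1) t - R n t t.
  rewrite /R -sumrN -big_split /=; apply: eq_bigr => x _; rewrite -sumrN -big_split /=.
  by apply: eq_bigr => y _; rewrite -sumrN -big_split /=; apply: eq_bigr => z _; rewrite /t; ring.
have E1 : R n t t = R (fun=> 1) t t - R t t t.
  rewrite /R -sumrN -big_split /=; apply: eq_bigr => x _; rewrite -sumrN -big_split /=.
  by apply: eq_bigr => y _; rewrite -sumrN -big_split /=; apply: eq_bigr => z _; rewrite /t; ring.
by rewrite E3 E2 E1 Rttt R1 R2 R3 Wnn Wnt Wtt.
Qed.

Let q s x := n x * a s x.
Let aqq s := \sum_x q s x * (\sum_z a x z * q s z).
Let f s y := (\sum_x (q s x + 4 * d s x) * g x y) + 0.

Let sum_c s : n s = 1 -> \sum_x (q s x + 4 * d s x) = 16.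
Proof.
move=> ns; rewrite big_split /= -mulr_sumr.
rewrite (eq_bigr (fun x => a s x * n x)) ?an ?ns => [|x _]; last by rewrite /q mulrC.
by rewrite (eq_bigr (fun x => d s x * 1)) ?(sum_d s (fun=> 1)) // => x _; rewrite mulr1.
Qed.

Let fE s y : n s = 1 ->
  f s y = 2 * q s y + 8 * d s y - (\sum_z a y z * q s z) - 4 * a s y + 48.
Proof.
move=> ns; have -> : f s y = \sum_x g y x * (q s x + 4 * d s x).
  by rewrite /f addr0; apply: eq_bigr => x _; rewrite mulrC (g_sym x).
rewrite (sum_g_mul y (fun x => q s x + 4 * d s x)) sum_c //.
have -> : \sum_z a y z * (q s z + 4 * d s z) = \sum_z a y z * q s z + 4 * a s y.
  rewrite (a_sym s) -(sum_d s (a y)) mulr_sumr -big_split /=; apply: eq_bigr => z _; ring.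
ring.
Qed.

(** For [s] among the forty vertices, [aqq s] counts ordered edges between its neighbours there.
    Being a sum of squares, the left side bounds [aqq s] by 24, while the forty values add up to
    [960 = 40 * 24]; equality everywhere yields [f_eq], a linear relation between the forty
    vectors. *)
Let norm_f s : n s = 1 -> \sum_y (f s y - 40 - 4 * n y) * (f s y - 40 - 4 * n y) = 240 - 10 * aqq s.
Proof.
move=> ns; have gf : good (f s) := good_comb (fun x => q s x + 4 * d s x) 0.
have sf : \sum_y f s y = 3200.
  by have := sum_comb (fun x => q s x + 4 * d s x) 0; rewrite sum_c // => ->.
have cE (h : T -> int) : \sum_x (q s x + 4 * d s x) * h x = \sum_x q s x * h x + 4 * h s.
  rewrite -[in 4 * _](sum_d s h) mulr_sumr -big_split /=; apply: eq_bigr => x _; ring.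
have qn (h : T -> int) : \sum_x q s x * h x = \sum_x a s x * (n x * h x).
  by apply: eq_bigr => x _; rewrite /q; ring.
have q1 : \sum_x a s x * n x = 12 by rewrite an ns.
have fn := sum_comb_mul (fun x => q s x + 4 * d s x) 0 gn.
have ff := sum_comb_mul (fun x => q s x + 4 * d s x) 0 gf.
rewrite -/(f s) in fn ff.
rewrite !cE sum_c // sn in fn; rewrite !cE sum_c // sf in ff.
have qn1 : \sum_x q s x * n x = 12.
  by rewrite qn -q1; apply: eq_bigr => x _; rewrite nn.
have qf : \sum_x q s x * f s x = 552 - aqq s.
  have -> : \sum_x q s x * f s x = 2 * (\sum_x q s x * n x) - aqq s + 44 * (\sum_x a s x * n x).
    rewrite !mulr_sumr -sumrN -!big_split /=; apply: eq_bigr => x _.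
    rewrite fE //; have dq : d s x * q s x = 0 by rewrite /q mulrCA (mulrC (d s x)) a_d mulr0.
    have aq : a s x * q s x = q s x by rewrite /q mulrCA a_idem.
    have nq : q s x * n x = q s x by rewrite /q mulrAC nn.
    have qq : q s x * q s x = q s x by rewrite {1}/q -mulrA aq mulrC nq.
    rewrite nq (mulrC (a s x)) -/(q s x).
    transitivity (2 * (q s x * q s x) + 8 * (d s x * q s x) - 4 * (a s x * q s x)
      - q s x * (\sum_z a x z * q s z) + 48 * q s x); first by ring.
    by rewrite qq dq aq; ring.
  by rewrite qn1 q1; ring.
have fs : f s s = 44.
  rewrite fE // a_irr d_refl {1}/q a_irr mulr0.
  have -> : \sum_z a s z * q s z = 12; last by [].
  by rewrite -q1; apply: eq_bigr => x _; rewrite /q mulrCA a_idem mulrC.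
have snn : \sum_u n u * n u = 40 by rewrite (eq_bigr n).
have -> : \sum_y (f s y - 40 - 4 * n y) * (f s y - 40 - 4 * n y) =
  \sum_y f s y * f s y - 80 * (\sum_y f s y) - 8 * (\sum_y f s y * n y)
  + 1600 * (\sum_(y : T) 1) + 320 * (\sum_y n y) + 16 * (\sum_y n y * n y).
  by rewrite !mulr_sumr -!sumrN -!big_split /=; apply: eq_bigr => y _; ring.
rewrite sum_1 sn snn sf.
move: fn ff; rewrite qn1 qf fs ns.
move: (\sum_y f s y * n y) (\sum_y f s y * f s y) => u v; lia.
Qed.

Let sum_aqq : \sum_s n s * aqq s = 960.
Proof.
rewrite -Rnnn /R; apply: eq_bigr => s _; rewrite /aqq mulr_sumr; apply: eq_bigr => x _.
rewrite mulrA mulr_sumr; apply: eq_bigr => z _; rewrite /q; ring.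
Qed.

Let aqq_le s : n s = 1 -> aqq s <= 24.
Proof.
move=> ns; have : 0 <= 240 - 10 * aqq s.
  by rewrite -(norm_f ns) sumr_ge0 // => y _; rewrite -expr2 sqr_ge0.
lia.
Qed.

Let f_eq s y : n s = 1 -> f s y = 40 + 4 * n y.
Proof.
move=> ns; suff : f s y - 40 - 4 * n y = 0 by lia.
have p (x : T) : true -> 0 <= n x * (24 - aqq x).
  by have [-> | nx] := n01 nn x; rewrite ?mul0r // nx mul1r subr_ge0 aqq_le.
have : \sum_x n x * (24 - aqq x) == 0.
  have -> : \sum_x n x * (24 - aqq x) = 24 * (\sum_x n x) - \sum_x n x * aqq x.
    by rewrite mulr_sumr -sumrN -big_split /=; apply: eq_bigr => x _; ring.
  by rewrite sn sum_aqq.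
rewrite psumr_eq0 // => /allP /(_ s (mem_index_enum s)) /=; rewrite ns mul1r subr_eq0 => /eqP E.
by apply: (sum_sq_eq0 (f := fun y => f s y - 40 - 4 * n y)); rewrite norm_f // -E.
Qed.

Let beta s x : n s = 1 -> n x = 0 -> \sum_z a x z * (n z * a s z) = 8 - 4 * a s x.
Proof.
move=> ns nx; have := f_eq x ns; rewrite fE // /q nx d_sym n_neq //.
move: (\sum_z _) => u; lia.
Qed.

(* [Q x] is 18 times the component of [x] orthogonal to the forty vertices of [n]; it lives in a plane. *)
Let Q x y := (\sum_z (18 * d x z + 3 * (n z * a x z)) * g z y) + (- 200) - 10 * n y.

Let gQ x : good (Q x).
Proof.
apply: (eq_good _ (good_lin 1 (- 10) 0 (good_comb (fun z => 18 * d x z + 3 * (n z * a x z)) (- 200)) gn)).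
by move=> y; rewrite /Q; ring.
Qed.

Let sum_cQ x (h : T -> int) : \sum_z (18 * d x z + 3 * (n z * a x z)) * h z =
  18 * h x + 3 * (\sum_z a x z * (n z * h z)).
Proof.
by rewrite -[in 18 * _](sum_d x h) !mulr_sumr -big_split /=; apply: eq_bigr => z _; ring.
Qed.

Let sum_cQ1 x : n x = 0 -> \sum_z (18 * d x z + 3 * (n z * a x z)) = 78.
Proof.
move=> nx; rewrite (eq_bigr (fun z => (18 * d x z + 3 * (n z * a x z)) * 1)); last first.
  by move=> z _; rewrite mulr1.
rewrite sum_cQ (eq_bigr (fun z => a x z * n z)) ?an ?nx // => z _; ring.
Qed.

Let sum_Q x : n x = 0 -> \sum_y Q x y = 0.
Proof.
by move=> nx; rewrite big_split /= sumrN -mulr_sumr sn sum_comb sum_cQ1.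
Qed.

Let QE x y : n x = 0 -> Q x y =
  36 * d x y + 6 * (n y * a x y) - 18 * a x y - 3 * (\sum_z a x z * (n z * a y z)) + 34 - 10 * n y.
Proof.
move=> nx; rewrite /Q.
have -> : \sum_z (18 * d x z + 3 * (n z * a x z)) * g z y =
    \sum_z g y z * (18 * d x z + 3 * (n z * a x z)).
  by apply: eq_bigr => z _; rewrite mulrC (g_sym z).
rewrite (sum_g_mul y (fun z => 18 * d x z + 3 * (n z * a x z))) sum_cQ1 //.
rewrite (eq_bigr (fun z => (18 * d x z + 3 * (n z * a x z)) * a y z)); last first.
  by move=> z _; rewrite mulrC.
by rewrite sum_cQ (a_sym y x); ring.
Qed.

Let Q0 x s : n x = 0 -> n s = 1 -> Q x s = 0.
Proof. by move=> nx ns; rewrite QE // beta // n_neq // ns (a_sym s); ring. Qed.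

Let nQ x y : n x = 0 -> n y * Q x y = 0.
Proof. by move=> nx; have [-> | ny] := n01 nn y; rewrite ?mul0r // Q0 ?mulr0. Qed.

Let QQ x z : n x = 0 -> n z = 0 -> \sum_y Q x y * Q z y = 180 * Q z x.
Proof.
move=> nx nz.
have -> : \sum_y Q x y * Q z y =
    \sum_y ((\sum_w (18 * d x w + 3 * (n w * a x w)) * g w y) + (- 200)) * Q z y.
  apply: eq_bigr => y _; apply/eqP; rewrite -subr_eq0 -mulrBl [X in X * _](_ : _ = - 10 * n y).
    by rewrite -(mulrA _ (n y)) (nQ y nz) mulr0.
  by rewrite /Q; ring.
have := sum_comb_mul (fun w => 18 * d x w + 3 * (n w * a x w)) (- 200) (gQ z).
have aQ : \sum_w a x w * (n w * Q z w) = 0 by rewrite big1 // => w _; rewrite nQ ?mulr0.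
rewrite sum_Q // sum_cQ aQ.
move: (\sum_y _) => u; lia.
Qed.

Let Q_sym x z : n x = 0 -> n z = 0 -> Q x z = Q z x.
Proof.
move=> nx nz; have := QQ nx nz; have := QQ nz nx.
rewrite (eq_bigr (fun y => Q x y * Q z y)) => [|y _]; last exact: mulrC.
move: (\sum_y _) => u; lia.
Qed.

Let Q_refl x : n x = 0 -> Q x x = 10.
Proof.
move=> nx; rewrite QE // a_irr d_refl nx (eq_bigr (fun z => a x z * n z)) ?an ?nx //.
by move=> z _; rewrite mulrCA a_idem mulrC.
Qed.

Let Q_adj x y : n x = 0 -> n y = 0 -> a x y = 1 -> Q x y = - 8.
Proof.
move=> nx ny axy; rewrite QE // axy ny.
have -> : \sum_z a x z * (n z * a y z) = 8.
  have -> : 8 = 8 * a x y by rewrite axy mulr1.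
  rewrite -sum_aa_edge; apply: eq_bigr => z _; rewrite axy mulr1.
  have H := aaat x y z; rewrite axy /t nx ny in H.
  by apply/eqP; rewrite eq_sym -subr_eq0 -[X in _ == X]H; apply/eqP; ring.
have := a_d x y; rewrite axy mul1r => ->.
ring.
Qed.

Let sum_lin3_sq (f1 f2 f3 : T -> int) (r1 r2 r3 : int) :
  \sum_u (r1 * f1 u + r2 * f2 u + r3 * f3 u) ^+ 2 =
    r1 * r1 * (\sum_u f1 u * f1 u) + r2 * r2 * (\sum_u f2 u * f2 u) + r3 * r3 * (\sum_u f3 u * f3 u)
    + 2 * r1 * r2 * (\sum_u f1 u * f2 u) + 2 * r2 * r3 * (\sum_u f2 u * f3 u)
    + 2 * r1 * r3 * (\sum_u f1 u * f3 u).
Proof. by rewrite !mulr_sumr -!big_split /=; apply: eq_bigr => u _; ring. Qed.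

(* The vectors [Q x] and [5 Q y + 4 Q x] are orthogonal, of norms 10 and 90. *)
Let bessel x y z : n x = 0 -> n y = 0 -> n z = 0 -> a x y = 1 ->
  9 * (Q x z * Q x z) + (5 * Q y z + 4 * Q x z) * (5 * Q y z + 4 * Q x z) <= 900.
Proof.
move=> nx ny nz axy; set P := 5 * Q y z + 4 * Q x z.
have : 0 <= \sum_u (90 * Q z u + (- (9 * Q x z + 4 * P)) * Q x u + (- (5 * P)) * Q y u) ^+ 2.
  by rewrite sumr_ge0 // => u _; rewrite sqr_ge0.
rewrite sum_lin3_sq.
rewrite (QQ nz nz) (QQ nx nx) (QQ ny ny) (QQ nz nx) (QQ nx ny) (QQ nz ny).
rewrite (Q_refl nx) (Q_refl ny) (Q_refl nz) (Q_sym ny nx) (Q_adj nx ny axy).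
rewrite [X in 0 <= X](_ : _ = 180 * 90 * (900 - (9 * (Q x z * Q x z) + P * P))).
  by rewrite pmulr_rge0 // subr_ge0.
by rewrite /P; ring.
Qed.

(** Summed over the 36 vertices, the inequalities of [bessel] become an equality, because two
    orthogonal vectors exhaust the plane; hence each is an equality. *)
Let bessel_eq x y z : n x = 0 -> n y = 0 -> n z = 0 -> a x y = 1 ->
  9 * (Q x z * Q x z) + (5 * Q y z + 4 * Q x z) * (5 * Q y z + 4 * Q x z) = 900.
Proof.
move=> nx ny nz axy.
pose B z := 900 * t z - (9 * (Q x z * Q x z) + (5 * Q y z + 4 * Q x z) * (5 * Q y z + 4 * Q x z)).
have B0 u : true -> 0 <= B u.
  move=> _; rewrite /B /t; have [nu|nu] := n01 nn u.
    by rewrite nu subr_ge0 subr0 mulr1 bessel.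
  by rewrite nu !Q0 //.
have : \sum_u B u == 0.
  have -> : \sum_u B u = 900 * (\sum_u t u) - 25 * (\sum_u Q x u * Q x u)
      - 25 * (\sum_u Q y u * Q y u) - 40 * (\sum_u Q x u * Q y u).
    by rewrite !mulr_sumr -!sumrN -!big_split /=; apply: eq_bigr => u _; rewrite /B; ring.
  by rewrite st !QQ // !Q_refl // (Q_sym ny nx) (Q_adj nx ny axy).
rewrite psumr_eq0 // => /allP /(_ z (mem_index_enum z)) /=.
by rewrite /B /t nz subr0 mulr1 subr_eq0 => /eqP.
Qed.

Lemma triangle_free_false : False.
Proof.
have [x nx] : exists x, n x = 0.
  case: (pickP (fun x => n x == 0)) => [x /eqP nx | H]; first by exists x.
  have := sn; rewrite (eq_bigr (fun=> 1)) ?sum_1 // => x _.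
  by have := H x; have [-> | ->] := n01 nn x.
have [y nay] : exists y, a x y * t y = 1.
  have [y nay] : exists y, a x y * t y != 0.
    apply/existsP; apply: contraT; rewrite negb_exists => /forallP H.
    have := at_ x; rewrite big1 ?nx // => y _; apply/eqP; have := H y; by rewrite negbK.
  exists y; move: nay; rewrite /t.
  by have [-> | ->] := a01 x y; have [-> | ->] := n01 nn y.
have [axy ny] : a x y = 1 /\ n y = 0.
  by move: nay; rewrite /t; have [-> | ->] := a01 x y; have [-> | ->] := n01 nn y.
(* At a neighbour [z] of [x] outside the forty, [Q x z = -8] turns [bessel_eq] into a quadratic
   equation for [Q y z] with roots 10 and 14/5, and [Q y z] is an integer. *)
have H z : a x z * Q y z = 10 * (a x z * t z).
  have [nz | nz] := n01 nn z; last by rewrite /t nz Q0 // subrr !mulr0.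
  have [-> | axz] := a01 x z; first by rewrite !mul0r.
  rewrite axz /t nz !mul1r subr0 mulr1; have := bessel_eq nx ny nz axy.
  rewrite (Q_adj nx nz axz); move: (Q y z) => b.
  have -> : (5 * b + 4 * -8) * (5 * b + 4 * -8) = 25 * (b * b) - 320 * b + 1024 by ring.
  move=> E; have : (b - 10) * (5 * b - 14) = 0 by nia.
  by move/eqP; rewrite mulf_eq0 => /orP[] /eqP; lia.
(* Goodness of [Q y] at [x] would now read [2 * (10 * 10) + 16 * (-8) = 0]. *)
have := gQ y x; rewrite sum_Q // (Q_adj ny nx) ?(a_sym y) // (eq_bigr _ (fun z _ => H z)).
by rewrite -mulr_sumr at_ nx.
Qed.

End TriangleFree.

Lemma sum_set_int (S : {set T}) (s f : T -> int) : (forall x, s x = (x \in S)%:R) ->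
  \sum_(x in S) (f x)%:~R = (\sum_x s x * f x)%:~R :> rat.
Proof.
move=> sS; rewrite rmorph_sum big_mkcond /=; apply: eq_bigr => x _.
by rewrite sS; case: (x \in S); rewrite ?mul1r ?mul0r.
Qed.

Lemma card_set_int (S : {set T}) (s : T -> int) : (forall x, s x = (x \in S)%:R) ->
  \sum_x s x = #|S|%:R.
Proof. by move=> sS; rewrite (eq_bigr _ (fun x _ => sS x)) sum_natb. Qed.

(** * Cocliques of size 16 *)

Section Coclique.

Variable m : T -> int.
Hypotheses (gm : good m) (sm : \sum_x m x = 16) (smm : \sum_x m x * m x = 16).

Let mm x : m x * m x = m x.
Proof. by apply: sum_idem; rewrite smm sm. Qed.

Let am x : \sum_y a x y * m y = 8 - 8 * m x.
Proof. have := gm x; rewrite sm; move: (\sum_y _) => s; lia. Qed.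

Let am0 x y : m x = 1 -> a x y * m y = 0.
Proof.
move=> mx; have := am x; rewrite mx => /eqP; rewrite psumr_eq0.
  by move=> /allP /(_ y (mem_index_enum y)) /eqP.
by move=> z _; have [-> | ->] := a01 x z; have [-> | ->] := n01 mm z.
Qed.

Let I x y := \sum_z a x z * (m z * a y z).

Let I_refl x : m x = 0 -> I x x = 8.
Proof.
move=> mx; have := am x; rewrite mx => H; rewrite -[RHS]H; apply: eq_bigr => z _.
by rewrite mulrCA a_idem mulrC.
Qed.

(* [K x] is 6 times the component of [x] orthogonal to the coclique [m]. *)
Let K x y := (\sum_z (6 * d x z + 3 * (m z * a x z)) * g z y) + (- 76) - 14 * m y.

Let gK x : good (K x).
Proof.
apply: (eq_good _ (good_lin 1 (- 14) 0 (good_comb (fun z => 6 * d x z + 3 * (m z * a x z)) (- 76)) gm)).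
by move=> y; rewrite /K; ring.
Qed.

Let sum_cK x (h : T -> int) : \sum_z (6 * d x z + 3 * (m z * a x z)) * h z =
  6 * h x + 3 * (\sum_z a x z * (m z * h z)).
Proof.
by rewrite -[in 6 * _](sum_d x h) !mulr_sumr -big_split /=; apply: eq_bigr => z _; ring.
Qed.

Let sum_cK1 x : m x = 0 -> \sum_z (6 * d x z + 3 * (m z * a x z)) = 30.
Proof.
move=> mx; rewrite (eq_bigr (fun z => (6 * d x z + 3 * (m z * a x z)) * 1)); last first.
  by move=> z _; rewrite mulr1.
rewrite sum_cK (eq_bigr (fun z => a x z * m z)) ?am ?mx // => z _; ring.
Qed.

Let sum_K x : m x = 0 -> \sum_y K x y = 0.
Proof. by move=> mx; rewrite big_split /= sumrN -mulr_sumr sm sum_comb sum_cK1. Qed.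

Let KE x y : m x = 0 ->
  K x y = 12 * d x y + 6 * (m y * a x y) - 6 * a x y - 3 * I x y + 14 - 14 * m y.
Proof.
move=> mx; rewrite /K.
have -> : \sum_z (6 * d x z + 3 * (m z * a x z)) * g z y =
    \sum_z g y z * (6 * d x z + 3 * (m z * a x z)).
  by apply: eq_bigr => z _; rewrite mulrC (g_sym z).
rewrite (sum_g_mul y (fun z => 6 * d x z + 3 * (m z * a x z))) sum_cK1 //.
rewrite (eq_bigr (fun z => (6 * d x z + 3 * (m z * a x z)) * a y z)); last first.
  by move=> z _; rewrite mulrC.
by rewrite sum_cK (a_sym y x) -/(I x y); ring.
Qed.

Let K0 x p : m x = 0 -> m p = 1 -> K x p = 0.
Proof.
move=> mx mp; rewrite KE // /I big1 => [|z _]; last by rewrite [m z * _]mulrC am0 ?mulr0.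
have -> : d x p = 0 by rewrite /d; case: eqVneq => [E|//]; rewrite E mp in mx.
rewrite mp; ring.
Qed.

Let mK x y : m x = 0 -> m y * K x y = 0.
Proof. by move=> mx; have [-> | my] := n01 mm y; rewrite ?mul0r // K0 ?mulr0. Qed.

Let KK x z : m x = 0 -> m z = 0 -> \sum_y K x y * K z y = 60 * K z x.
Proof.
move=> mx mz.
have -> : \sum_y K x y * K z y =
    \sum_y ((\sum_w (6 * d x w + 3 * (m w * a x w)) * g w y) + (- 76)) * K z y.
  apply: eq_bigr => y _; apply/eqP; rewrite -subr_eq0 -mulrBl [X in X * _](_ : _ = - 14 * m y).
    by rewrite -(mulrA _ (m y)) (mK y mz) mulr0.
  by rewrite /K; ring.
have := sum_comb_mul (fun w => 6 * d x w + 3 * (m w * a x w)) (- 76) (gK z).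
have aK : \sum_w a x w * (m w * K z w) = 0 by rewrite big1 // => w _; rewrite mK ?mulr0.
rewrite sum_K // sum_cK aK.
move: (\sum_y _) => u; lia.
Qed.

Let K_sym x z : m x = 0 -> m z = 0 -> K x z = K z x.
Proof.
move=> mx mz; have := KK mx mz; have := KK mz mx.
rewrite (eq_bigr (fun y => K x y * K z y)) => [|y _]; last exact: mulrC.
move: (\sum_y _) => u; lia.
Qed.

Let K_refl x : m x = 0 -> K x x = 2.
Proof. by move=> mx; rewrite KE // a_irr d_refl mx I_refl. Qed.

Let sum_diff x y : m x = 0 -> m y = 0 ->
  \sum_u (K x u - K y u) * (K x u - K y u) = 240 - 120 * K x y.
Proof.
move=> mx my.
have -> : \sum_u (K x u - K y u) * (K x u - K y u) =
  \sum_u K x u * K x u + \sum_u K y u * K y u - 2 * (\sum_u K x u * K y u).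
  by rewrite mulr_sumr -sumrN -!big_split /=; apply: eq_bigr => u _; ring.
by rewrite !KK // !K_refl // (K_sym my mx); ring.
Qed.

Let sum_add x y : m x = 0 -> m y = 0 ->
  \sum_u (K x u + K y u) * (K x u + K y u) = 240 + 120 * K x y.
Proof.
move=> mx my.
have -> : \sum_u (K x u + K y u) * (K x u + K y u) =
  \sum_u K x u * K x u + \sum_u K y u * K y u + 2 * (\sum_u K x u * K y u).
  by rewrite mulr_sumr -!big_split /=; apply: eq_bigr => u _; ring.
by rewrite !KK // !K_refl // (K_sym my mx); ring.
Qed.

(** By [KE] these values are 2 modulo 3, and Cauchy-Schwarz bounds them by 2 in absolute value.
    Distinct projections are thus at 120 degrees in a plane. *)
Let K_vals x y : m x = 0 -> m y = 0 -> K x y = 2 \/ K x y = - 1.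
Proof.
move=> mx my.
have h1 : 0 <= \sum_u (K x u - K y u) * (K x u - K y u).
  by rewrite sumr_ge0 // => u _; rewrite -expr2 sqr_ge0.
have h2 : 0 <= \sum_u (K x u + K y u) * (K x u + K y u).
  by rewrite sumr_ge0 // => u _; rewrite -expr2 sqr_ge0.
rewrite sum_diff // in h1; rewrite sum_add // in h2.
move: h1 h2; rewrite KE // my !mul0r.
move: (d x y) (a x y) (I x y) => i1 i2 i3; lia.
Qed.

Lemma coclique_false : False.
Proof.
have [b mb] : exists b, m b = 0.
  case: (pickP (fun x => m x == 0)) => [x /eqP mx | H]; first by exists x.
  have := sm; rewrite (eq_bigr (fun=> 1)) ?sum_1 // => x _.
  by have := H x; have [-> | ->] := n01 mm x.
have [p mp] : exists p, m p = 1.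
  case: (pickP (fun x => m x == 1)) => [x /eqP mx | H]; first by exists x.
  have := sm; rewrite big1 => [//|x _].
  by have := H x; have [-> | ->] := n01 mm x.
pose U := [set x | K b x == 2]; pose C := [set x | m x == 1].
have mC x : m x = (x \in C)%:R by rewrite inE; have [-> | ->] := n01 mm x.
have mU x : x \in U -> m x = 0.
  by rewrite inE; have [-> // | mx] := n01 mm x; rewrite K0.
have KU x y : x \in U -> K x y = K b y.
  move=> xU; have mx := mU x xU; have := xU; rewrite inE => /eqP Kx.
  apply/eqP; rewrite eq_sym -subr_eq0; apply/eqP.
  by apply: (sum_sq_eq0 (f := fun y => K b y - K x y)); rewrite sum_diff // Kx.
pose s x : int := (x \in U)%:R.
(* Outside the coclique [K b] takes only the values 2 and -1, with total 0, so [U] is one third of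
   the sixty vertices. *)
have sE x : 3 * s x = K b x + 1 - m x.
  rewrite /s inE; have [mx | mx] := n01 mm x; last by rewrite K0 // mx.
  by have [-> | ->] := K_vals mb mx; rewrite mx.
have s3 (f : T -> int) : 3 * (\sum_x s x * f x) = \sum_x f x * K b x + \sum_x f x - \sum_x f x * m x.
  rewrite mulr_sumr -sumrN -!big_split /=; apply: eq_bigr => x _.
  by rewrite mulrA sE; ring.
have cU : #|U| = 20%N.
  have := s3 (fun=> 1); rewrite sum_1 (eq_bigr s) => [|x _]; last by rewrite mulr1.
  rewrite [X in _ = X + _ - _](eq_bigr (K b)) => [|x _]; last by rewrite mul1r.
  rewrite [X in _ = _ - X](eq_bigr m) => [|x _]; last by rewrite mul1r.
  rewrite sum_K // sm (card_set_int (S := U)) //; lia.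
have cC : #|C| = 16%N by have := card_set_int mC; rewrite sm; lia.
have sUE (f : T -> int) : \sum_(x in U) f x = \sum_x s x * f x.
  rewrite big_mkcond; apply: eq_bigr => x _.
  by rewrite /s; case: (x \in U); rewrite ?mul1r ?mul0r.
(* Each vertex of [U] has 8 neighbours among the 16 of [C], so its sign vector is orthogonal to the
   all-one vector. The vector [v] is the coordinate vector at [p] made orthogonal to it, of norm
   [15 / 16 = 15 / (2 * 8)]. *)
pose X x q : rat := (1 - 2 * a x q)%:~R.
pose v q : rat := (q == p)%:R - 1 / 16.
have sumC1 : \sum_(q in C) 1 = 16 :> rat by rewrite sumr_const cC.
have XC x : x \in U -> \sum_(q in C) X x q = 0.
  move=> xU; rewrite (sum_set_int _ mC).
  have -> : \sum_q m q * (1 - 2 * a x q) = \sum_q m q - 2 * (\sum_q a x q * m q).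
    by rewrite mulr_sumr -sumrN -big_split /=; apply: eq_bigr => q _; ring.
  by rewrite sm am mU.
have sum_p (f : T -> rat) : \sum_(q in C) (q == p)%:R * f q = f p.
  rewrite (bigD1 p) /=; last by rewrite inE mp.
  by rewrite eqxx mul1r big1 ?addr0 // => q /andP[_ /negbTE ->]; rewrite mul0r.
apply: (@no_regular_gram T U C a X (fun x => 1 - 2 * a x p) (fun=> 1) v 8) => //.
- by move=> x y _ _; exact: a_sym.
- by move=> x y _ _; exact: a_idem.
- by move=> x _; exact: a_irr.
- move=> x xU; have := s3 (a x); have := gK b x; rewrite sum_K // sum_a am mU //.
  rewrite -sUE; have := xU; rewrite inE => /eqP ->.
  move: (\sum_(y in U) _) (\sum_y _) => u w; lia.
- move=> x y xU yU; rewrite /X.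
  rewrite (eq_bigr (fun q => ((1 - 2 * a x q) * (1 - 2 * a y q))%:~R)); last first.
    by move=> q _; rewrite intrM.
  rewrite (sum_set_int _ mC).
  have -> : \sum_q m q * ((1 - 2 * a x q) * (1 - 2 * a y q)) =
     \sum_q m q - 2 * (\sum_q a x q * m q) - 2 * (\sum_q a y q * m q) + 4 * I x y.
    by rewrite !mulr_sumr -!sumrN -!big_split /=; apply: eq_bigr => q _; ring.
  rewrite sm !am (mU x) // (mU y) //.
  have := KE y (mU x xU); rewrite KU //; have := yU; rewrite inE => /eqP ->.
  rewrite (mU y) // => H.
  have -> : I x y = 4 * d x y - 2 * a x y + 4.
    by move: H; move: (d x y) (a x y) (I x y) => i1 i2 i3; lia.
  have -> : (x == y)%:R = (d x y)%:~R :> rat by rewrite /d; case: (x == y).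
  rewrite !(intrD, intrM, intrB); ring.
- by move=> x xU; rewrite (eq_bigr (X x)) ?XC // => q _; rewrite mulr1.
- have -> : \sum_(q in C) v q * 1 = \sum_(q in C) (q == p)%:R * 1 - 1 / 16 * (\sum_(q in C) 1).
    by rewrite mulr_sumr -sumrN -big_split /=; apply: eq_bigr => q _; rewrite /v; ring.
  by rewrite sum_p sumC1.
- have -> : \sum_(q in C) v q * v q = \sum_(q in C) (q == p)%:R * ((q == p)%:R - 1 / 8) 
     + 1 / 256 * (\sum_(q in C) 1).
    by rewrite mulr_sumr -big_split /=; apply: eq_bigr => q _; rewrite /v; field.
  by rewrite sum_p sumC1 eqxx.
- move=> x xU.
  have -> : \sum_(q in C) X x q * v q = \sum_(q in C) (q == p)%:R * X x q - 1 / 16 * (\sum_(q in C) X x q).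
    by rewrite mulr_sumr -sumrN -big_split /=; apply: eq_bigr => q _; rewrite /v; ring.
  by rewrite sum_p XC // mulr0 subr0.
- by move=> x _; have [-> | ->] := a01 x p.
Qed.

End Coclique.

(** * Induced K_{6,10} *)

Section Bipartite.

Variable m : T -> int.
Hypotheses (gm : good m) (sm : \sum_x m x = 80) (smm : \sum_x m x * m x = 100).

Let am x : \sum_y a x y * m y = 40 - 8 * m x.
Proof. have := gm x; rewrite sm; move: (\sum_y _) => s; lia. Qed.

Let s1 : \sum_x m x * (m x - 1) = 20.
Proof.
have -> : \sum_x m x * (m x - 1) = \sum_x m x * m x - \sum_x m x.
  by rewrite -sumrN -big_split /=; apply: eq_bigr => x _; ring.
by rewrite sm smm.
Qed.

Let s2 : \sum_x (m x - 1) * (m x - 2) = 12.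
Proof.
have -> : \sum_x (m x - 1) * (m x - 2) = \sum_x m x * m x - 3 * (\sum_x m x) + 2 * (\sum_(x : T) 1).
  by rewrite !mulr_sumr -sumrN -!big_split /=; apply: eq_bigr => x _; ring.
by rewrite sm smm sum_1.
Qed.

Let ge1 x : 0 <= m x * (m x - 1).
Proof. by rewrite mulrBr mulr1 int_sq_ge. Qed.

Let ge2 x : 0 <= (m x - 1) * (m x - 2).
Proof.
have -> : (m x - 1) * (m x - 2) = (m x - 1) * (m x - 1) - (m x - 1) by ring.
exact: int_sq_ge.
Qed.

Let le_nbr x (f : T -> int) : (forall y, 0 <= f y) -> \sum_y a x y * f y <= \sum_y f y.
Proof.
by move=> f0; apply: ler_sum => y _; have [-> | ->] := a01 x y; rewrite ?mul0r ?mul1r.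
Qed.

(** From [2 m = 2 + m (m - 1) - (m - 1) (m - 2)] and the totals 20 and 12 of the two non-negative
    products, the sum of [2 m] over the neighbours of [x] lies between [60 - 12] and [60 + 20]; by
    [am] it is [80 - 16 m x]. *)
Let m_vals x : [\/ m x = 0, m x = 1 | m x = 2].
Proof.
have h1 : 2 * (\sum_y a x y * m y) <= 80.
  have -> : 2 * (\sum_y a x y * m y) = 2 * (\sum_y a x y) + \sum_y a x y * (m y * (m y - 1))
      - \sum_y a x y * ((m y - 1) * (m y - 2)).
    by rewrite !mulr_sumr -sumrN -!big_split /=; apply: eq_bigr => y _; ring.
  have := le_nbr x ge1; rewrite s1 sum_a.
  have : 0 <= \sum_y a x y * ((m y - 1) * (m y - 2)).
    by apply: sumr_ge0 => y _; have [-> | ->] := a01 x y; rewrite ?mul0r ?mul1r.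
  move: (\sum_y _) (\sum_y _) => u w; lia.
have h2 : 48 <= 2 * (\sum_y a x y * m y).
  have -> : 2 * (\sum_y a x y * m y) = 2 * (\sum_y a x y) + \sum_y a x y * (m y * (m y - 1))
      - \sum_y a x y * ((m y - 1) * (m y - 2)).
    by rewrite !mulr_sumr -sumrN -!big_split /=; apply: eq_bigr => y _; ring.
  have := le_nbr x ge2; rewrite s2 sum_a.
  have : 0 <= \sum_y a x y * (m y * (m y - 1)).
    by apply: sumr_ge0 => y _; have [-> | ->] := a01 x y; rewrite ?mul0r ?mul1r.
  move: (\sum_y _) (\sum_y _) => u w; lia.
rewrite am in h1 h2.
have [E|[E|E]] : m x = 0 \/ m x = 1 \/ m x = 2 by move: h1 h2; move: (m x) => i; lia.
- by constructor 1.
- by constructor 2.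
- by constructor 3.
Qed.

Let p x : int := (m x == 2)%:R.
Let z x : int := (m x == 0)%:R.

Let pE x : 2 * p x = m x * (m x - 1).
Proof. by rewrite /p; case: (m_vals x) => ->. Qed.

Let zE x : 2 * z x = (m x - 1) * (m x - 2).
Proof. by rewrite /z; case: (m_vals x) => ->. Qed.

Let mE x : m x = 1 + p x - z x.
Proof. by rewrite /p /z; case: (m_vals x) => ->. Qed.

Let p1 x : m x = 1 -> p x = 0. Proof. by rewrite /p => ->. Qed.
Let z1 x : m x = 1 -> z x = 0. Proof. by rewrite /z => ->. Qed.

Let sp : \sum_x p x = 10.
Proof.
have : 2 * (\sum_x p x) = 20 by rewrite -s1 mulr_sumr; apply: eq_bigr => x _; rewrite pE.
lia.
Qed.

Let sz : \sum_x z x = 6.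
Proof.
have : 2 * (\sum_x z x) = 12 by rewrite -s2 mulr_sumr; apply: eq_bigr => x _; rewrite zE.
lia.
Qed.

Let p0 x : 0 <= p x. Proof. by rewrite /p; case: eqP. Qed.
Let z0 x : 0 <= z x. Proof. by rewrite /z; case: eqP. Qed.

Let apz x : \sum_y a x y * p y = \sum_y a x y * z y + 10 - 8 * m x.
Proof.
have := am x; have -> : \sum_y a x y * m y = \sum_y a x y + \sum_y a x y * p y - \sum_y a x y * z y.
  by rewrite -sumrN -!big_split /=; apply: eq_bigr => y _; rewrite mE; ring.
rewrite sum_a; move: (\sum_y a x y * p y) (\sum_y a x y * z y) => u w; lia.
Qed.

(** Such a vertex has ten more neighbours with [m = 2] than with [m = 0], and only ten vertices have
    [m = 2]. *)
Let az0 x : m x = 0 -> \sum_y a x y * z y = 0.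
Proof.
move=> mx; have := apz x; have := le_nbr x p0; rewrite sp mx.
have : 0 <= \sum_y a x y * z y.
  by apply: sumr_ge0 => y _; have [-> | ->] := a01 x y; rewrite ?mul0r ?mul1r.
move: (\sum_y a x y * p y) (\sum_y a x y * z y) => u w; lia.
Qed.

Let chi y := (\sum_x z x * g x y) + 0.

Let chiE y : chi y = 2 * z y - (\sum_x a y x * z x) + 18.
Proof.
have -> : chi y = \sum_x g y x * z x.
  by rewrite /chi addr0; apply: eq_bigr => x _; rewrite mulrC (g_sym x).
by rewrite sum_g_mul sz.
Qed.

Let zm x : z x * m x = 0. Proof. by rewrite /z; case: eqP => [->|_]; rewrite ?mulr0 ?mul0r. Qed.

(** The six vertices with [m = 0] and four copies of the root add up to a multiple of the sum of all
    vertices, since the difference has norm 0. This fixes the adjacencies to the ten and the six: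
    complete between them, none inside either, and 4 and 2 neighbours for each remaining vertex. *)
Let chi_eq y : chi y = 20 - 4 * m y.
Proof.
have gchi : good chi := good_comb z 0.
have schi : \sum_x chi x = 1200 by rewrite sum_comb sz.
have zchi : \sum_x z x * chi x = 120.
  have -> : 120 = 20 * (\sum_x z x) by rewrite sz.
  rewrite mulr_sumr; apply: eq_bigr => x _; rewrite chiE /z.
  by case: eqP => [mx | _]; rewrite ?mul0r ?mulr0 // az0.
have zm0 : \sum_x z x * m x = 0 by rewrite big1 // => x _; exact: zm.
have c2 := sum_comb_mul z 0 gchi; have c1 := sum_comb_mul z 0 gm.
rewrite -/chi zchi schi sz in c2; rewrite -/chi zm0 sm sz in c1.
suff : chi y - 20 + 4 * m y = 0 by lia.
apply: (sum_sq_eq0 (f := fun y => chi y - 20 + 4 * m y)).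
have -> : \sum_x (chi x - 20 + 4 * m x) * (chi x - 20 + 4 * m x) =
   \sum_x chi x * chi x - 40 * (\sum_x chi x) + 8 * (\sum_x chi x * m x) + 400 * (\sum_(x : T) 1)
   - 160 * (\sum_x m x) + 16 * (\sum_x m x * m x).
  by rewrite !mulr_sumr -!sumrN -!big_split /=; apply: eq_bigr => x _; ring.
rewrite sum_1 sm smm schi.
move: c1 c2.
rewrite (_ : \sum_x (\sum_w z w * g w x + 0) * m x = \sum_x chi x * m x) //.
rewrite (_ : \sum_x (\sum_w z w * g w x + 0) * chi x = \sum_x chi x * chi x) //.
move: (\sum_x chi x * chi x) (\sum_x chi x * m x) => u w; lia.
Qed.

Let az x : \sum_y a x y * z y = 2 * z x - 2 + 4 * m x.
Proof. have := chi_eq x; rewrite chiE; move: (\sum_y _) => u; lia. Qed.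

Let ap x : \sum_y a x y * p y = 2 * z x + 8 - 4 * m x.
Proof. by rewrite apz az; ring. Qed.

Let full (f : T -> int) x y : (forall u, f u = 0 \/ f u = 1) -> \sum_u a x u * f u = \sum_u f u ->
  a x y * f y = f y.
Proof.
move=> f01 E; have : \sum_u (f u - a x u * f u) == 0 by rewrite big_split /= sumrN E subrr.
rewrite psumr_eq0 => [/allP /(_ y (mem_index_enum y))|u _].
  by rewrite /= subr_eq0 => /eqP <-.
by have [-> | ->] := a01 x u; have [-> | ->] := f01 u.
Qed.

Let empty (f : T -> int) x y : (forall u, 0 <= f u) -> \sum_u a x u * f u = 0 -> a x y * f y = 0.
Proof.
move=> f0 /eqP; rewrite psumr_eq0 => [/allP /(_ y (mem_index_enum y)) /eqP //|u _].
by have [-> | ->] := a01 x u; rewrite ?mul0r ?mul1r.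
Qed.

Let I x y := \sum_w a x w * ((p w + z w) * a y w).

(* [K x] is twice the component of [x] orthogonal to the vertices with [m != 1]. *)
Let K x y := (\sum_w (2 * d x w + (p w + z w) * a x w) * g w y) + (- 20) - m y.

Let gK x : good (K x).
Proof.
apply: (eq_good _ (good_lin 1 (- 1) 0 (good_comb (fun w => 2 * d x w + (p w + z w) * a x w) (- 20)) gm)).
by move=> y; rewrite /K; ring.
Qed.

Let sum_cK x (h : T -> int) : \sum_w (2 * d x w + (p w + z w) * a x w) * h w =
  2 * h x + \sum_w a x w * ((p w + z w) * h w).
Proof.
by rewrite -[in 2 * _](sum_d x h) !mulr_sumr -big_split /=; apply: eq_bigr => w _; ring.
Qed.

Let sum_cK1 x : m x = 1 -> \sum_w (2 * d x w + (p w + z w) * a x w) = 8.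
Proof.
move=> mx; rewrite (eq_bigr (fun w => (2 * d x w + (p w + z w) * a x w) * 1)); last first.
  by move=> w _; rewrite mulr1.
rewrite sum_cK (_ : \sum_w _ = \sum_w a x w * p w + \sum_w a x w * z w).
  by rewrite ap az mx z1.
by rewrite -big_split /=; apply: eq_bigr => w _; ring.
Qed.

Let sum_K x : m x = 1 -> \sum_y K x y = 0.
Proof. by move=> mx; rewrite big_split /= sumrN sm sum_comb sum_cK1. Qed.

Let KE x y : m x = 1 ->
  K x y = 4 * d x y + 2 * ((p y + z y) * a x y) - 2 * a x y - I x y + 4 - m y.
Proof.
move=> mx; rewrite /K.
have -> : \sum_w (2 * d x w + (p w + z w) * a x w) * g w y =
    \sum_w g y w * (2 * d x w + (p w + z w) * a x w).
  by apply: eq_bigr => w _; rewrite mulrC (g_sym w).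
rewrite (sum_g_mul y (fun w => 2 * d x w + (p w + z w) * a x w)) sum_cK1 //.
rewrite (eq_bigr (fun w => (2 * d x w + (p w + z w) * a x w) * a y w)); last first.
  by move=> w _; rewrite mulrC.
by rewrite sum_cK (a_sym y x) -/(I x y); ring.
Qed.

Let p01 x : p x = 0 \/ p x = 1. Proof. by rewrite /p; case: eqP; [right | left]. Qed.
Let z01 x : z x = 0 \/ z x = 1. Proof. by rewrite /z; case: eqP; [right | left]. Qed.

(** For [m y = 2] or [m y = 0], the neighbours of [y] in the [K_{6,10}] are exactly the other side,
    so [I x y] reduces to a count given by [az] or [ap]. *)
Let K0 x y : m x = 1 -> m y != 1 -> K x y = 0.
Proof.
move=> mx my; rewrite KE //.
have -> : d x y = 0 by rewrite /d; case: eqVneq => [E|//]; rewrite -E mx in my.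
case: (m_vals y) => E; last 1 first.
- have -> : I x y = \sum_w a x w * z w.
    apply: eq_bigr => w _; have := @full z y w z01; rewrite az sz E /z E => /(_ erefl) H.
    have := @empty p y w p0; rewrite ap /z E => /(_ erefl) H'.
    rewrite mulrDl (mulrC (p w)) H' add0r (mulrC _ (a y w)); congr (_ * _).
    exact: H.
  have [-> ->] : p y = 1 /\ z y = 0 by rewrite /p /z E.
  by rewrite az mx z1 // E; ring.
- have -> : I x y = \sum_w a x w * p w.
    apply: eq_bigr => w _; have := @full p y w p01; rewrite ap sp E /z E => /(_ erefl) H.
    have := @empty z y w z0; rewrite az /z E => /(_ erefl) H'.
    rewrite mulrDl (mulrC (z w)) H' addr0 (mulrC _ (a y w)); congr (_ * _).
    exact: H.
  have [-> ->] : p y = 0 /\ z y = 1 by rewrite /p /z E.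
  by rewrite ap mx z1 // E; ring.
- by rewrite E in my.
Qed.

Let mK x y : m x = 1 -> (m y - 1) * K x y = 0.
Proof.
move=> mx; have [-> | my] := eqVneq (m y) 1; first by rewrite subrr mul0r.
by rewrite K0 // mulr0.
Qed.

Let pzK x y : m x = 1 -> (p y + z y) * K x y = 0.
Proof.
move=> mx; have [my | my] := eqVneq (m y) 1; first by rewrite p1 ?z1 // add0r mul0r.
by rewrite K0 // mulr0.
Qed.

Let KK x w : m x = 1 -> m w = 1 -> \sum_y K x y * K w y = 20 * K w x.
Proof.
move=> mx mw.
have -> : \sum_y K x y * K w y =
    \sum_y ((\sum_u (2 * d x u + (p u + z u) * a x u) * g u y) + (- 20)) * K w y - \sum_y K w y.
  rewrite -sumrN -big_split /=; apply: eq_bigr => y _.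
  transitivity (K x y * K w y + (m y - 1) * K w y); first by rewrite mK // addr0.
  by rewrite {1}/K; ring.
have := sum_comb_mul (fun u => 2 * d x u + (p u + z u) * a x u) (- 20) (gK w).
have aK : \sum_u a x u * ((p u + z u) * K w u) = 0 by rewrite big1 // => u _; rewrite pzK ?mulr0.
rewrite sum_K // sum_cK aK.
move: (\sum_y _) => u; lia.
Qed.

Let K_sym x w : m x = 1 -> m w = 1 -> K x w = K w x.
Proof.
move=> mx mw; have := KK mx mw; have := KK mw mx.
rewrite (eq_bigr (fun y => K x y * K w y)) => [|y _]; last exact: mulrC.
move: (\sum_y _) => u; lia.
Qed.

Let I_sum x y : I x y = \sum_w p w * (a x w * a y w) + \sum_w z w * (a x w * a y w).
Proof. by rewrite -big_split /=; apply: eq_bigr => w _; ring. Qed.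

Let K_refl x : m x = 1 -> K x x = 1.
Proof.
move=> mx; have refl (h : T -> int) : \sum_w h w * (a x w * a x w) = \sum_w a x w * h w.
  by apply: eq_bigr => w _; rewrite a_idem mulrC.
by rewrite KE // a_irr d_refl I_sum !refl ap az mx z1 // p1.
Qed.

Let sum_lin x y (c : int) : m x = 1 -> m y = 1 ->
  \sum_u (K x u - c * K y u) * (K x u - c * K y u) = 20 + 20 * (c * c) - 40 * (c * K y x).
Proof.
move=> mx my.
have -> : \sum_u (K x u - c * K y u) * (K x u - c * K y u) =
  \sum_u K x u * K x u + c * c * (\sum_u K y u * K y u) - 2 * c * (\sum_u K x u * K y u).
  by rewrite !mulr_sumr -sumrN -!big_split /=; apply: eq_bigr => u _; ring.
by rewrite !KK // !K_refl //; ring.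
Qed.

Let K_vals x y : m x = 1 -> m y = 1 -> [\/ K x y = 0, K x y = 1 | K x y = - 1].
Proof.
move=> mx my.
have h (c : int) : 0 <= \sum_u (K y u - c * K x u) * (K y u - c * K x u).
  by rewrite sumr_ge0 // => u _; rewrite -expr2 sqr_ge0.
have := h 1; have := h (- 1); rewrite !sum_lin //; move: (K x y) => k h1 h2.
have [->|[->|->]] : k = 0 \/ k = 1 \/ k = - 1 by lia.
- by constructor 1.
- by constructor 2.
- by constructor 3.
Qed.

Let rsum (S : {set T}) (s : T -> int) (f : T -> int) (alpha beta : rat) : (forall q, s q = (q \in S)%:R) ->
  \sum_(q in S) (alpha * (f q)%:~R + beta) = alpha * (\sum_q f q * s q)%:~R + beta * #|S|%:R.
Proof.
move=> sS; rewrite big_split /= -mulr_sumr (sum_set_int _ sS) sumr_const mulr_natr.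
by congr (alpha * _%:~R + _); apply: eq_bigr => q _; rewrite mulrC.
Qed.

Lemma bipartite_false : False.
Proof.
have [b mb] : exists b, m b = 1.
  case: (pickP (fun x => m x == 1)) => [x /eqP mx | H]; first by exists x.
  have : \sum_(x : T) 1 = \sum_x (p x + z x).
    by apply: eq_bigr => x _; have := H x; rewrite /p /z; case: (m_vals x) => ->.
  by rewrite sum_1 big_split /= sp sz.
(* [U] collects the vertices whose projection is plus or minus that of [b], and [h] is the sign. *)
pose U := [set x | K b x != 0]; pose h x := K b x.
pose P := [set x | m x == 2]; pose Z := [set x | m x == 0]; pose C := [set x | m x != 1].
have pP x : p x = (x \in P)%:R by rewrite inE.
have zZ x : z x = (x \in Z)%:R by rewrite inE.
have cP : #|P| = 10%N by have := card_set_int pP; rewrite sp; lia.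
have cZ : #|Z| = 6%N by have := card_set_int zZ; rewrite sz; lia.
have CE (F : T -> rat) : \sum_(q in C) F q = \sum_(q in P) F q + \sum_(q in Z) F q.
  rewrite !(big_mkcond (fun q => q \in _)) -big_split /=; apply: eq_bigr => q _.
  by rewrite !inE; case: (m_vals q) => -> /=; rewrite ?addr0 ?add0r.
have cC : #|C| = 16%N.
  have : #|C|%:R = (#|P| + #|Z|)%:R :> rat by rewrite natrD -!sumr_const CE.
  by move/eqP; rewrite eqr_nat cP cZ => /eqP.
have mU x : x \in U -> m x = 1.
  by rewrite inE; apply: contraNeq => mx; rewrite K0.
have hU x : x \in U -> h x = 1 \/ h x = - 1.
  move=> xU; have := xU; rewrite inE -/(h x) /h => Kx.
  by case: (K_vals mb (mU x xU)) Kx => ->; [|left|right].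
have hh x : x \in U -> h x * h x = 1 by move=> /hU [] ->.
have KU x y : x \in U -> K x y = h x * h y.
  move=> xU; have mx := mU x xU; apply/eqP; rewrite -subr_eq0; apply/eqP.
  apply: (sum_sq_eq0 (f := fun y => K x y - h x * h y)).
  by rewrite sum_lin // -/(h x) hh.
have sUE (f : T -> int) : \sum_(x in U) f x * h x = \sum_x f x * h x.
  rewrite big_mkcond; apply: eq_bigr => x _; rewrite inE -/(h x).
  by case: eqP => // ->; rewrite mulr0.
have cU : #|U| = 20%N.
  have : \sum_(x in U) h x * h x = 20 by rewrite sUE KK // K_refl.
  rewrite (eq_bigr (fun=> 1)) => [|x xU]; last exact: hh.
  rewrite sumr_const; lia.
have sh : \sum_(x in U) h x = 0.
  have := sUE (fun=> 1); rewrite (eq_bigr h) => [->|x _]; last by rewrite mul1r.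
  by rewrite (eq_bigr (K b)) ?sum_K // => x _; rewrite mul1r.
(* Seidel switching with respect to the sign [h]: adjacency is complemented between opposite
   signs. *)
pose a' x y := if h x == h y then a x y else 1 - a x y.
have a'E x y : x \in U -> y \in U -> 2 * a' x y = 1 - h x * h y + 2 * (h x * (a x y * h y)).
  move=> xU yU; have n1 : (1 == - 1 :> int) = false by [].
  have n2 : (- 1 == 1 :> int) = false by [].
  by case: (hU x xU) => Ex; case: (hU y yU) => Ey; rewrite /a' Ex Ey ?(eqxx, n1, n2); ring.
(* With these shifts the Gram matrix of the signed rows of [X] is [2 (2 - A)] without correction term. *)
pose alpha q : rat := if m q == 2 then 3 / 10 else 1 / 6.
pose X x q : rat := (h x)%:~R * ((a x q)%:~R - alpha q).
have aP q : q \in P -> alpha q = 3 / 10 by rewrite inE /alpha => ->.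
have aZ q : q \in Z -> alpha q = 1 / 6 by rewrite inE /alpha => /eqP ->.
(* The rows of [X] sum to [h x] both on [P] ([4 - 10 * 3/10 = 1]) and on [Z] ([2 - 6 * 1/6 = 1]),
   hence are orthogonal to [k]. The weights of [v] satisfy [3/8 + 5/8 = 1], [10 * 3/8 = 6 * 5/8] and
   give the norm [15/4 = 15 / (2 * 2)]. *)
pose k q : rat := if m q == 2 then 1 else - 1.
pose v q : rat := if m q == 2 then 3 / 8 else 5 / 8.
have kP q : q \in P -> k q = 1 by rewrite inE /k => ->.
have kZ q : q \in Z -> k q = - 1 by rewrite inE /k => /eqP ->.
have vP q : q \in P -> v q = 3 / 8 by rewrite inE /v => ->.
have vZ q : q \in Z -> v q = 5 / 8 by rewrite inE /v => /eqP ->.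
have XP x : x \in U -> \sum_(q in P) X x q = (h x)%:~R.
  move=> xU; have mx := mU x xU.
  rewrite (eq_bigr (fun q => (h x)%:~R * (a x q)%:~R + - (3 / 10) * (h x)%:~R)); last first.
    by move=> q qP; rewrite /X aP //; ring.
  by rewrite (rsum _ _ _ pP) ap mx z1 // cP; field.
have XZ x : x \in U -> \sum_(q in Z) X x q = (h x)%:~R.
  move=> xU; have mx := mU x xU.
  rewrite (eq_bigr (fun q => (h x)%:~R * (a x q)%:~R + - (1 / 6) * (h x)%:~R)); last first.
    by move=> q qZ; rewrite /X aZ //; ring.
  by rewrite (rsum _ _ _ zZ) az mx z1 // cZ; field.
apply: (@no_regular_gram T U C a' X h k v 2) => //.
- by move=> x y _ _; rewrite /a' eq_sym a_sym.
- move=> x y _ _; rewrite /a'; case: eqP => _; first exact: a_idem.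
  by have [-> | ->] := a01 x y.
- by move=> x _; rewrite /a' eqxx a_irr.
- move=> x xU; have : 2 * (\sum_(y in U) a' x y) = 4; last by lia.
  rewrite mulr_sumr (eq_bigr (fun y => (1 - h x * h y) + 2 * h x * (a x y * h y))); last first.
    by move=> y yU; rewrite a'E //; ring.
  rewrite big_split /= -mulr_sumr sUE big_split /= sumrN -mulr_sumr sh sumr_const cU.
  have := gK b x; rewrite sum_K // -/(h x) => H.
  have -> : \sum_y a x y * h y = - 8 * h x by move: H; rewrite /h; move: (\sum_y _) => u; lia.
  transitivity (20 - 16 * (h x * h x)); last by rewrite hh.
  ring.
- move=> x y xU yU; rewrite CE.
  have part (S : {set T}) (s : T -> int) (c : rat) : (forall q, s q = (q \in S)%:R) ->
      (forall q, q \in S -> alpha q = c) ->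
      \sum_(q in S) X x q * X y q = (h x * h y)%:~R * ((\sum_q s q * (a x q * a y q))%:~R
        - c * (\sum_q a x q * s q)%:~R - c * (\sum_q a y q * s q)%:~R + c * c * #|S|%:R).
    move=> sS aS.
    have -> : \sum_(q in S) X x q * X y q = \sum_(q in S) ((h x * h y)%:~R * (a x q * a y q)%:~R + 0)
       + \sum_(q in S) (- c * (h x * h y)%:~R * (a x q)%:~R + 0)
       + \sum_(q in S) (- c * (h x * h y)%:~R * (a y q)%:~R + c * c * (h x * h y)%:~R).
      rewrite -!big_split /=; apply: eq_bigr => q qS; rewrite /X aS // !intrM; ring.
    rewrite !(rsum _ _ _ sS).
    rewrite (_ : \sum_q a x q * a y q * s q = \sum_q s q * (a x q * a y q)); first by ring.
    by apply: eq_bigr => q _; rewrite mulrC.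
  rewrite (part P p _ pP aP) (part Z z _ zZ aZ) !ap !az (mU x) // (mU y) // !z1 ?mU // cP cZ.
  have := KE y (mU x xU); rewrite KU // (mU y) // p1 ?mU // z1 ?mU // I_sum.
  move: (\sum_q _) (\sum_q _) => i1 i2 H.
  have -> : (x == y)%:R = (d x y)%:~R :> rat by rewrite /d; case: (x == y).
  have dh : d x y * (h x * h y) = d x y.
    by rewrite /d; case: eqVneq => [->|_]; rewrite ?mul0r // hh // mulr1.
  have hh2 : (h x * h y) * (h x * h y) = 1 by rewrite mulrACA !hh.
  have E : (h x * h y) * (i1 + i2 - 2) = 4 * d x y - 2 * a' x y.
    rewrite a'E //; have -> : i1 + i2 = 4 * d x y - 2 * a x y + 3 - h x * h y by rewrite H; ring.
    transitivity (4 * (d x y * (h x * h y)) - 2 * (h x * (a x y * h y)) + h x * h y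
       - (h x * h y) * (h x * h y)); first by ring.
    by rewrite dh hh2; ring.
  transitivity (((h x * h y) * (i1 + i2 - 2))%:~R : rat).
    by rewrite !(intrM, intrB, intrD); field.
  by rewrite E !(intrM, intrB); ring.
- move=> x xU; rewrite CE (eq_bigr (X x)) => [|q qP]; last by rewrite kP ?mulr1.
  rewrite XP // [X in _ + X](eq_bigr (fun q => - X x q)) => [|q qZ]; last by rewrite kZ ?mulrN1.
  by rewrite sumrN XZ // subrr.
- rewrite CE (eq_bigr (fun=> 1)) => [|q qP]; last by rewrite kP ?mulr1.
  rewrite [X in _ + X](eq_bigr (fun=> 1)) => [|q qZ]; last by rewrite kZ ?mulrNN ?mulr1.
  by rewrite !sumr_const cP cZ.
- rewrite CE (eq_bigr (fun=> 3 / 8)) => [|q qP]; last by rewrite kP ?vP ?mulr1.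
  rewrite [X in _ + X](eq_bigr (fun=> - (5 / 8))) => [|q qZ]; last by rewrite kZ ?vZ ?mulrN1.
  by rewrite !sumr_const cP cZ.
- rewrite CE (eq_bigr (fun=> 3 / 8 * (3 / 8))) => [|q qP]; last by rewrite vP.
  rewrite [X in _ + X](eq_bigr (fun=> 5 / 8 * (5 / 8))) => [|q qZ]; last by rewrite vZ.
  by rewrite !sumr_const cP cZ.
- move=> x xU; rewrite CE.
  transitivity (3 / 8 * (\sum_(q in P) X x q) + 5 / 8 * (\sum_(q in Z) X x q)).
    rewrite !mulr_sumr; congr (_ + _); apply: eq_bigr => q qS.
      by rewrite vP // mulrC.
    by rewrite vZ // mulrC.
  by rewrite XP // XZ //; field.
Qed.

End Bipartite.

(** * The case distinction *)

Lemma srg_76_30_8_14_false : False.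
Proof.
case: (boolP [exists x, exists y, exists u, exists v,
    [&& e x y, e x u, e x v, e y u, e y v & e u v]]) => [H | H].
  have [x /existsP [y /existsP [u /existsP [v]]]] := existsP H.
  case/and5P=> exy exu exv eyu /andP[eyv euv].
  have [n [gn sn nn]] := clique_good exy exu exv eyu eyv euv.
  case: (boolP [exists x, exists y, exists z,
      [&& e x y, e x z, e y z, n x == 0, n y == 0 & n z == 0]]) => [H' | H'].
    have [x' /existsP [y' /existsP [z']]] := existsP H'.
    case/and5P=> exy' exz' eyz' /eqP nx /andP[/eqP ny /eqP nz].
    have [[m [gm sm smm]] | [m [gm sm smm]]] :=
      triangle_dichotomy gn sn nn exy' exz' eyz' nx ny nz.
      exact: coclique_false gm sm smm.
    exact: bipartite_false gm sm smm.
  apply: (triangle_free_false gn sn nn) => x' y' z' exy' exz' eyz' nx ny nz.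
  move/negP: H'; apply; apply/existsP; exists x'; apply/existsP; exists y'; apply/existsP; exists z'.
  by rewrite exy' exz' eyz' nx ny nz.
apply: clique_free_false => x y u v exy exu exv eyu eyv euv.
move/negP: H; apply; apply/existsP; exists x; apply/existsP; exists y.
apply/existsP; exists u; apply/existsP; exists v.
by rewrite exy exu exv eyu eyv euv.
Qed.

End Srg.

Theorem mainTheorem1 (T : finType) (e : rel T) : ~ srg e 76 30 8 14.
Proof. exact: srg_76_30_8_14_false. Qed.
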